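(* For all sufficiently large real numbers $X$, one has $$\int_{[0,1)^3}\Biggl|\sum_{1\le x,y\le X}e\bigl(\alpha_1x+\alpha_2y+\alpha_3(x^3+y^3)\bigr)\Biggr|^5\,d\alpha_1\,d\alpha_2\,d\alpha_3\asymp X^5,$$ where the sum is over pairs of integers $x,y$ and the implicit constants are absolute.
   Context: Here $e(z)=e^{2\pi iz}$. The notation $F(X)\asymp G(X)$ means $F(X)\ll G(X)\ll F(X)$ in Vinogradov's notation, that is, there are absolute positive constants $c_1,c_2$ with $c_1G(X)\le F(X)\le c_2G(X)$. *)

(* Defs.v *)
From HB Require Import structures.
From mathcomp Require Export all_boot all_order all_algebra.
From mathcomp Require Export all_classical all_reals all_analysis.
From mathcomp.real_closed Require Export complex.

Set Implicit Arguments.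
Unset Strict Implicit.
Unset Printing Implicit Defensive.
Import Order.TTheory GRing.Theory Num.Theory.
Import numFieldNormedType.Exports.
Local Open Scope classical_set_scope.
Local Open Scope ring_scope.

Definition e2pi (R : realType) (z : R) : R[i] :=
  Complex (cos (2 * pi * z)) (sin (2 * pi * z)).

(* The indices x, y run over the integers of [1, X]: [Num.truncn X] is the
   floor of X when X >= 0, and 0 otherwise. *)
Definition exp_sum (R : realType) (X a1 a2 a3 : R) : R[i] :=
  \sum_(1 <= x < (Num.truncn X).+1) \sum_(1 <= y < (Num.truncn X).+1)
    e2pi (a1 * x%:R + a2 * y%:R + a3 * (x%:R ^+ 3 + y%:R ^+ 3)).

Definition lebesgue3 (R : realType) :=
  ((@lebesgue_measure R \x @lebesgue_measure R) \x @lebesgue_measure R)%E.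
Arguments lebesgue3 R : clear implicits.

Definition unit_cube (R : realType) : set (R * R * R) :=
  `[0, 1[ `*` `[0, 1[ `*` `[0, 1[.
Arguments unit_cube R : clear implicits.

(* [Normc.normc z : R] is the modulus of [z]; [`|z|] would live in [R[i]]. *)
Definition fifth_moment (R : realType) (X : R) : \bar R :=
  \int[lebesgue3 R]_(a in unit_cube R)
    (Normc.normc (exp_sum X a.1.1 a.1.2 a.2) ^+ 5)%:E.

(* F(X) and G(X) have the same order of magnitude for all sufficiently
   large X; c1 and c2 do not depend on X. *)
Definition asymp_large (R : realType) (F G : R -> \bar R) : Prop :=
  exists c1 c2 : R, [/\ 0 < c1, 0 < c2 &
    \forall X \near +oo,
      (c1%:E * G X <= F X)%E /\ (F X <= c2%:E * G X)%E].

(* Main.v *)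
Require Import Defs.
From mathcomp Require Import zify ring lra measurable_realfun.
Set Implicit Arguments.
Unset Strict Implicit.
Unset Printing Implicit Defensive.
Import Order.TTheory GRing.Theory Num.Theory.
Import numFieldNormedType.Exports.

(** Write [P] for the integer part of [X] and [f(a, b)] for the sum of
    [e(a x + b x^3)] over [1 <= x <= P].  The double sum factors as
    [f(a1, a3) f(a2, a3)], so the integral is the mean over [b] of [F5(b)^2],
    where [Fk(b)] is the mean over [a] of [|f(a, b)|^k].  All means are first
    taken over fractions [i / N], [j / N] with [N] large: orthogonality is then
    exact for trigonometric polynomials of degree below [N], and since the
    integrand is Lipschitz the integral differs from the discrete mean by at
    most 1 ([fifth_moment_riemann]).

    Lower bound.  By orthogonality [F2(b) = P], and convexity gives
    [F5(b)^2 >= P^5] for every [b] ([moment5_lower]).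

    Upper bound.  Diagonal solutions and points near rationals both contribute
    the full order [P^5], so no logarithm may be lost in either.  Expanding
    squares twice gives [F4(b) <= 10 P^2 + 16 |A(b)|], where the off-diagonal
    part [A] is a sum over [h] and [k] of geometric progressions in [x]
    ([fourth_moment_le]).

    Where [F4] is of order [P^2], Cauchy-Schwarz gives [F5^2 <= F4 F6], and the
    mean of [F6] counts the solutions of a linear and a cubic equation in six
    variables.  The sums in pairs of the variables satisfy
    [u1 u2 u3 = v1 v2 v3], [u1 + u2 + u3 = v1 + v2 + v3]; the products force a
    matrix of order 3 with row products [u] and column products [v]
    ([factor33]), and then the sums determine the largest entry of the matrix
    from the other eight unless some [u] equals some [v].  That saves a power
    of [P] over the diagonal ([size_equal_sum_prod_le]).

    Elsewhere [F4] is at most [32 |A|].  As [f] is Lipschitz in [a], one large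
    value of [|f|] forces [F4] to be large: [S^5 << P^2 F4] for the supremum
    [S] ([sup_le_fourth]).  Hence if [|A|] is about [32^-r P^3], then
    [S << 2^-r P], and [F5 <= S F4] yields [F5^2 << 4^-r P^2 |A|^2]
    ([moment5_level]).
    - If [2^r] exceeds a power of [log P], the mean square of [A] suffices; it
      is [O(P^3 (log P)^6)], again by counting matrices
      ([second_moment_offdiag], [size_equal_prod]).
    - For smaller [r], the size of [A] forces [6 b] to lie near a fraction
      [a / q], with both [q] and [T = P^3 |6 b - a / q|] at most
      [K = 2^(20 r + 27)] ([rational_approx]), and there
      [A << P^3 tau(q) / (q sqrt(1 + T))] ([major_arc]).  The mean of
      [|A|^2] over all these arcs is [P^3] times a power of the harmonic sum up
      to [K] ([arcs_average]), that is a polynomial in [r], which the factor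
      [4^-r] absorbs. *)

Notation rng n := (index_iota 1 n.+1).

(** * Multiplicative equations *)

Section Factorisations.

Lemma mem_rng n a : (a \in rng n) = (0 < a <= n)%N.
Proof. by rewrite mem_index_iota ltnS. Qed.

(** Solution counts below are bounded by exhibiting a parametrisation, which
    need only be surjective. *)
Lemma size_surj (S T : eqType) (s : seq S) (t : seq T) (g : T -> S) :
  uniq s -> (forall x, x \in s -> exists2 y, y \in t & g y = x) ->
  (size s <= size t)%N.
Proof.
move=> us H; rewrite -(size_map g t); apply: uniq_leq_size => // x /H [y yt <-].
exact: map_f.
Qed.

(** Take [x] to be the gcd of [a] and [c]; the cofactor of [x] in [a] is then
    coprime to that of [c] and divides [d]. *)
Lemma factor22 a b c d : (0 < a)%N -> (a * b = c * d)%N ->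
  exists x y z w, [/\ a = x * y, b = z * w, c = x * z & d = y * w]%N.
Proof.
move=> a0 abcd; set x := gcdn a c.
have x0 : (0 < x)%N by rewrite gcdn_gt0 a0.
have ea : a = (x * (a %/ x))%N by rewrite mulnC divnK // dvdn_gcdl.
have ec : c = (x * (c %/ x))%N by rewrite mulnC divnK // dvdn_gcdr.
set y := (a %/ x)%N in ea *; set z := (c %/ x)%N in ec *.
have cop : coprime y z.
  by rewrite /coprime -(eqn_pmul2l x0) muln_gcdr -ea -ec muln1.
have yb : (y * b = z * d)%N.
  by apply/eqP; rewrite -(eqn_pmul2l x0) !mulnA -ea -ec abcd.
have /dvdnP [w ew] : (y %| d)%N by rewrite -(Gauss_dvdr _ cop) -yb dvdn_mulr.
exists x, y, z, w; split => //; last by rewrite mulnC.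
have y0 : (0 < y)%N by case: (posnP y) ea a0 => // ->; rewrite muln0 => ->.
by apply/eqP; rewrite -(eqn_pmul2l y0) yb ew; apply/eqP; lia.
Qed.

(** Three applications of the two-factor case: the unknown matrix [a b c; d e
    f; g h i] has row products [u] and column products [v]. *)
Lemma factor33 u1 u2 u3 v1 v2 v3 :
  (0 < u1)%N -> (0 < u2)%N -> (0 < u3)%N ->
  (u1 * u2 * u3 = v1 * v2 * v3)%N ->
  exists a b c d e f g h i, [/\ [/\ u1 = a * b * c, u2 = d * e * f & u3 = g * h * i]
   & [/\ v1 = a * d * g, v2 = b * e * h & v3 = c * f * i]]%N.
Proof.
move=> p1 p2 p3; rewrite -!mulnA => /(factor22 p1) [x [y [z [w [e1 e23 f1 f23]]]]].
have [p [q [r [s [eu2 eu3 ez ew]]]]] := factor22 p2 e23.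
have v0 : (0 < v1 * (v2 * v3))%N by rewrite f1 f23; move: (muln_gt0 u2 u3); rewrite e23 p2 p3 e1 in p1 *; rewrite !muln_gt0 in p1 *; lia.
have v20 : (0 < v2)%N by move: v0; rewrite !muln_gt0; lia.
have [p' [q' [r' [s' [ev2 ev3 ey ew']]]]] := factor22 v20 f23.
have q0 : (0 < q)%N by move: p2; rewrite eu2 muln_gt0; lia.
have [a [b [c [d [? ? ? ?]]]]] := factor22 q0 (etrans (esym ew) ew').
exists x, p', r', p, a, b, r, c, d; subst; split; split; lia.
Qed.

Definition triples n : seq (nat * nat * nat) :=
  [seq (ab, c) | ab <- [seq (a, b) | a <- rng n, b <- rng n], c <- rng n].
Definition prod3 (t : nat * nat * nat) := (t.1.1 * t.1.2 * t.2)%N.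
Definition sum3 (t : nat * nat * nat) := (t.1.1 + t.1.2 + t.2)%N.
Definition triples_le M := [seq t <- triples M | (prod3 t <= M)%N].

Lemma uniq_triples n : uniq (triples n).
Proof.
apply: allpairs_uniq; rewrite ?iota_uniq //; last by move=> [? ?] [? ?] _ _ [-> ->].
by apply: allpairs_uniq; rewrite ?iota_uniq // => -[? ?] [? ?] _ _ [-> ->].
Qed.

Lemma mem_triples n a b c :
  ((a, b, c) \in triples n) = [&& (0 < a <= n)%N, (0 < b <= n)%N & (0 < c <= n)%N].
Proof.
rewrite -!mem_rng; apply/allpairsP/and3P => [[[[x y] z] /= [/allpairsP [[p q]] /= [? ? [-> ->]] ? [-> -> ->]]] //|[ha hb hc]].
exists ((a, b), c); split => //=; apply/allpairsP; by exists (a, b).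
Qed.

Definition equal_prod M :=
  [seq p <- [seq (u, v) | u <- triples M, v <- triples M] | prod3 p.1 == prod3 p.2].

Lemma uniq_triple_pairs M : uniq [seq (u, v) | u <- triples M, v <- triples M].
Proof. by apply: allpairs_uniq; rewrite ?uniq_triples // => -[? ?] [? ?] _ _ [-> ->]. Qed.

Lemma mem_triple_pairs M u v :
  ((u, v) \in [seq (u, v) | u <- triples M, v <- triples M]) = (u \in triples M) && (v \in triples M).
Proof.
apply/allpairsP/andP => [[[? ?] /= [? ? [-> ->]]] // | [? ?]]; by exists (u, v).
Qed.

Lemma mem_triples_le M a b c :
  ((a, b, c) \in triples_le M) = [&& 0 < a, 0 < b, 0 < c & a * b * c <= M]%N.
Proof.
rewrite mem_filter mem_triples /prod3 /=; apply/idP/idP; first by case/and4P; lia.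
case/and4P => a0 b0 c0 h; rewrite h a0 b0 c0 /=.
have := leq_pmulr a b0; have := leq_pmulr (a * b) c0; have := leq_pmull b a0; have := leq_pmull c (leq_mul a0 b0).
lia.
Qed.

(** The rows of the matrix in [factor33] are three independent triples of
    bounded product. *)
Lemma size_equal_prod M : (size (equal_prod M) <= size (triples_le M) ^ 3)%N.
Proof.
pose t3 := [seq (x, r) | x <- [seq (p, q) | p <- triples_le M, q <- triples_le M], r <- triples_le M].
have -> : (size (triples_le M) ^ 3 = size t3)%N by rewrite /t3 !size_allpairs; lia.
pose g (x : (nat * nat * nat) * (nat * nat * nat) * (nat * nat * nat)) :=
  let: ((a, b, c), (d, e, f), (g, h, i)) := x in
  (((a * b * c), (d * e * f), (g * h * i)), ((a * d * g), (b * e * h), (c * f * i)))%N.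
apply: (@size_surj _ _ _ _ g); first exact/filter_uniq/uniq_triple_pairs.
move=> [[[u1 u2] u3] [[v1 v2] v3]]; rewrite mem_filter mem_triple_pairs !mem_triples /prod3 /=.
case/and3P => /eqP E /and3P [/andP [u10 u1M] /andP [u20 u2M] /andP [u30 u3M]] _.
have [a [b [c [d [e [f [g' [h [i [[e1 e2 e3] [f1 f2 f3]]]]]]]]]]] := factor33 u10 u20 u30 E.
exists ((a, b, c), (d, e, f), (g', h, i)); last by rewrite /= -e1 -e2 -e3 -f1 -f2 -f3.
apply/allpairsP; exists ((a, b, c, (d, e, f)), (g', h, i)); split => //=.
- apply/allpairsP; exists ((a, b, c), (d, e, f)); split => //=; rewrite mem_triples_le -?e1 -?e2 ?u1M ?u2M.
  + by move: u10; rewrite e1 !muln_gt0 => /andP [/andP [-> ->] ->].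
  + by move: u20; rewrite e2 !muln_gt0 => /andP [/andP [-> ->] ->].
- rewrite mem_triples_le -e3 u3M.
  by move: u30; rewrite e3 !muln_gt0 => /andP [/andP [-> ->] ->].
Qed.

Definition equal_sum_prod M := [seq p <- equal_prod M | sum3 p.1 == sum3 p.2].

(** The condition says that [a b] is at most [M^(2/3)]: if [g], [h] are at
    most [i] and [g h i <= M], then [(g h)^3 <= M^2]. *)
Definition small_pairs M :=
  [seq p <- [seq (a, b) | a <- rng M, b <- rng M] | ((p.1 * p.2) ^ 3 <= M ^ 2)%N].

Lemma max_mem (s : seq nat) x : x \in s ->
  exists2 m, m \in s & forall y, y \in s -> (y <= m)%N.
Proof.
elim: s x => // a s IH x _.
case: s IH => [_|b s /(_ b (mem_head _ _)) [m ms hm]].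
  by exists a; rewrite ?mem_head // => y; rewrite inE => /eqP ->.
exists (maxn a m); last first.
  by move=> y; rewrite inE leq_max => /predU1P[->|/hm ->]; rewrite ?leqnn ?orbT.
by rewrite /maxn; case: ifP => _; rewrite ?mem_head // inE ms orbT.
Qed.

(** Both pairs are the roots of the same quadratic. *)
Lemma mul_sum_inj u1 u2 v1 v2 : (u1 + u2 = v1 + v2)%N -> (u1 * u2 = v1 * v2)%N ->
  (v1 = u1 /\ v2 = u2) \/ (v1 = u2 /\ v2 = u1).
Proof.
move=> s p.
have : ((Posz u1 - Posz v1) * (Posz u1 - Posz v2) = 0)%R by nia.
move/eqP; rewrite mulf_eq0 => /orP [] /eqP; lia.
Qed.

(** Parameters for the solutions of both equations.  The left summand holds
    the diagonal ones, up to the order of two entries; the right one holds a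
    square matrix of order 3 without its largest entry. *)
Let params M : seq ((bool * (nat * nat * nat)) +
  ((nat * nat * nat) * (nat * nat * nat) * (nat * nat))) :=
  map inl [seq (b, x) | b <- [:: true; false], x <- triples M] ++
  map inr [seq (x, y) | x <- [seq (p, q) | p <- triples_le M, q <- triples_le M], y <- small_pairs M].

(** The entry [i] missing from a matrix solves the linear equation [a b c + d
    e f + g h i = a d g + b e h + c f i], whose coefficient of [i] is [g h - c
    f]. *)
Let recover (y : (bool * (nat * nat * nat)) +
    ((nat * nat * nat) * (nat * nat * nat) * (nat * nat))) :
    (nat * nat * nat) * (nat * nat * nat) :=
  match y with
  | inl (b, (x, y, z)) => ((x, y, z), if b then (x, y, z) else (y, x, z))
  | inr ((a, b, c), (d, e, f), (g, h)) =>
    let i := (`|Posz (a * b * c + d * e * f) - Posz (a * d * g + b * e * h)| %/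
              `|Posz (c * f) - Posz (g * h)|)%N in
    ((a * b * c, d * e * f, g * h * i), (a * d * g, b * e * h, c * f * i))%N
  end.

Lemma recover_mem M a b c d e f g h i :
  let u1 := (a * b * c)%N in let u2 := (d * e * f)%N in let u3 := (g * h * i)%N in
  let v1 := (a * d * g)%N in let v2 := (b * e * h)%N in let v3 := (c * f * i)%N in
  (0 < u1 <= M)%N -> (0 < u2 <= M)%N -> (0 < u3 <= M)%N ->
  (u1 + u2 + u3 = v1 + v2 + v3)%N -> (g <= i)%N -> (h <= i)%N ->
  exists2 y, y \in params M & recover y = ((u1, u2, u3), (v1, v2, v3)).
Proof.
move=> u1 u2 u3 v1 v2 v3 h1 h2 h3 hs gi hi.
have [uv3|nuv3] := eqVneq u3 v3.
  have p12 : (u1 * u2 = v1 * v2)%N.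
    apply/eqP; rewrite -(@eqn_pmul2r u3); last by lia.
    rewrite {2}uv3 /u1 /u2 /u3 /v1 /v2 /v3; apply/eqP; lia.
  have s12 : (u1 + u2 = v1 + v2)%N by lia.
  have ub : (u1, u2, u3) \in triples M by rewrite mem_triples h1 h2 h3.
  have [[-> ->]|[-> ->]] := mul_sum_inj s12 p12; rewrite -uv3.
    exists (inl (true, (u1, u2, u3))) => //; rewrite mem_cat map_f //.
    by rewrite mem_cat map_f.
  exists (inl (false, (u1, u2, u3))) => //; rewrite mem_cat map_f //.
  by rewrite mem_cat orbC mem_cat map_f.
move: h1 h2 h3; rewrite /u1 /u2 /u3 !muln_gt0 -!andbA.
case/and4P => a0 b0 c0 h1 /and4P [d0 e0 f0 h2] /and4P [g0 h0 i0 h3].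
have ne : (c * f != g * h)%N.
  by apply: contraNN nuv3 => /eqP; rewrite /u3 /v3 => ->.
exists (inr ((a, b, c), (d, e, f), (g, h))).
  rewrite mem_cat; apply/orP; right; apply: map_f.
  apply/allpairsP; exists ((a, b, c), (d, e, f), (g, h)); split => //=.
    by apply/allpairsP; exists ((a, b, c), (d, e, f)); rewrite !mem_triples_le a0 b0 c0 d0 e0 f0.
  have ghM : (g * h * (g * h) <= M * g * h)%N.
    apply: (@leq_trans ((g * h * i) * (g * h))%N); first by nia.
    nia.
  have gM : (g <= M)%N by nia.
  have hM : (h <= M)%N by nia.
  rewrite mem_filter /=; apply/andP; split; last first.
    by apply/allpairsP; exists (g, h); rewrite !mem_rng g0 h0 gM hM.
  apply: (@leq_trans ((g * h * i) ^ 2)%N); last by rewrite leq_exp2r.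
  by rewrite expnSr (expnMn (g * h)) leq_mul // -(mulnn i) leq_mul.
rewrite /recover.
suff -> : (`|Posz (a * b * c + d * e * f) - Posz (a * d * g + b * e * h)| %/
              `|Posz (c * f) - Posz (g * h)|)%N = i by [].
have -> : (Posz (a * b * c + d * e * f) - Posz (a * d * g + b * e * h) =
           Posz i * (Posz (c * f) - Posz (g * h)))%R.
  by move: hs; rewrite /u1 /u2 /u3 /v1 /v2 /v3; lia.
rewrite abszM absz_nat mulnK //; lia.
Qed.

Let rot3 (t : nat * nat * nat) := (t.1.2, t.2, t.1.1).

(** The factor 9 accounts for the position of the largest entry of the matrix,
    which cyclic shifts of the rows and of the columns bring to the corner. *)
Lemma size_equal_sum_prod M :
  (size (equal_sum_prod M) <= 9 * (2 * M ^ 3 + size (triples_le M) ^ 2 * size (small_pairs M)))%N.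
Proof.
pose t := [seq (ij, y) | ij <- [seq (i, j) | i <- iota 0 3, j <- iota 0 3], y <- params M].
have -> : (9 * (2 * M ^ 3 + size (triples_le M) ^ 2 * size (small_pairs M)) = size t)%N.
  rewrite /t size_allpairs /params size_cat !size_map.
  have -> : size [seq (b, x) | b <- [:: true; false], x <- triples M] = (2 * M ^ 3)%N.
    by rewrite size_allpairs /triples !size_allpairs !size_iota /=; lia.
  by rewrite !size_allpairs /=; lia.
pose g (z : (nat * nat) * ((bool * (nat * nat * nat)) +
    ((nat * nat * nat) * (nat * nat * nat) * (nat * nat)))) :=
  (iter z.1.1 rot3 (recover z.2).1, iter z.1.2 rot3 (recover z.2).2).
apply: (@size_surj _ _ _ _ g).
  exact/filter_uniq/filter_uniq/uniq_triple_pairs.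
move=> [[[u1 u2] u3] [[v1 v2] v3]]; rewrite mem_filter mem_filter mem_triple_pairs !mem_triples /prod3 /sum3 /=.
case/and4P => /eqP S /eqP E /and3P [h1 h2 h3] _.
have [u10 u20 u30] : [/\ 0 < u1, 0 < u2 & 0 < u3]%N by split; lia.
have [a [b [c [d [e [f [x [h [i [[e1 e2 e3] [f1 f2 f3]]]]]]]]]]] := factor33 u10 u20 u30 E.
have key k l y : y \in params M -> (k < 3)%N -> (l < 3)%N ->
    g (k, l, y) = ((u1, u2, u3), (v1, v2, v3)) ->
    exists2 z, z \in t & g z = ((u1, u2, u3), (v1, v2, v3)).
  move=> yd k3 l3 gy; exists (k, l, y) => //; apply/allpairsP; exists ((k, l), y); split => //.
  by apply/allpairsP; exists (k, l); rewrite !mem_iota.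
have [m ms hm] := max_mem (mem_head a [:: b; c; d; e; f; x; h; i]).
have la := hm a; have lb := hm b; have lc := hm c; have ld := hm d; have le := hm e.
have lf := hm f; have lx := hm x; have lh := hm h; have li := hm i.
rewrite !inE !eqxx ?orbT in la lb lc ld le lf lx lh li.
have {}la := la isT. have {}lb := lb isT. have {}lc := lc isT. have {}ld := ld isT.
have {}le := le isT. have {}lf := lf isT. have {}lx := lx isT. have {}lh := lh isT. have {}li := li isT.
move: ms; rewrite !inE.
Ltac fin key g k l y yd ry := apply: (key k l y yd) => //; rewrite /g ry /= /rot3 /=;
  congr ((_, _, _), (_, _, _)); lia.
move=> /orP [/eqP em|/orP [/eqP em|/orP [/eqP em|/orP [/eqP em|/orP [/eqP em|/orP [/eqP em|/orP [/eqP em|/orP [/eqP em|/eqP em]]]]]]]]; subst m u1 u2 u3 v1 v2 v3.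
- have [|||||| y yd ry] := @recover_mem M e f d h i x b c a; try lia. by fin key g 2%N 2%N y yd ry.
- have [|||||| y yd ry] := @recover_mem M f d e i x h c a b; try lia. by fin key g 2%N 1%N y yd ry.
- have [|||||| y yd ry] := @recover_mem M d e f x h i a b c; try lia. by fin key g 2%N 0%N y yd ry.
- have [|||||| y yd ry] := @recover_mem M h i x b c a e f d; try lia. by fin key g 1%N 2%N y yd ry.
- have [|||||| y yd ry] := @recover_mem M i x h c a b f d e; try lia. by fin key g 1%N 1%N y yd ry.
- have [|||||| y yd ry] := @recover_mem M x h i a b c d e f; try lia. by fin key g 1%N 0%N y yd ry.
- have [|||||| y yd ry] := @recover_mem M b c a e f d h i x; try lia. by fin key g 0%N 2%N y yd ry.
- have [|||||| y yd ry] := @recover_mem M c a b f d e i x h; try lia. by fin key g 0%N 1%N y yd ry.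
- have [|||||| y yd ry] := @recover_mem M a b c d e f x h i; try lia. by fin key g 0%N 0%N y yd ry.
Qed.

End Factorisations.

(** * Harmonic sums and counting bounds *)

Section Harmonic.
Local Open Scope ring_scope.
Variable R : realFieldType.

Definition harm (n : nat) : R := \sum_(1 <= a < n.+1) a%:R^-1.

Lemma harm_ge0 n : 0 <= harm n.
Proof. by apply: sumr_ge0 => i _; rewrite invr_ge0. Qed.

Lemma harmS n : harm n.+1 = harm n + n.+1%:R^-1.
Proof. by rewrite /harm big_nat_recr. Qed.

Lemma harm_le m n : (m <= n)%N -> harm m <= harm n.
Proof.
move=> /subnK <-; elim: (n - m)%N => // k IH.
by rewrite addSn harmS (le_trans IH) // lerDl invr_ge0.
Qed.

(** Each dyadic block contributes at most 1. *)
Lemma harm_pow2 k : harm (2 ^ k) <= k.+1%:R.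
Proof.
elim: k => [|k IH]; first by rewrite /harm expn0 big_nat1 invr1.
have le2 : (2 ^ k <= 2 ^ k.+1)%N by rewrite leq_exp2l.
rewrite /harm (@big_cat_nat _ _ _ (2 ^ k).+1) //=.
rewrite -[k.+2]addn1 natrD lerD //.
apply: (@le_trans _ _ (\sum_((2 ^ k).+1 <= i < (2 ^ k.+1).+1) ((2 ^ k)%:R^-1 : R))).
  apply: ler_sum_nat => i /andP [h1 h2]; rewrite lef_pV2 ?posrE ?ltr0n ?expn_gt0 //; last by lia.
  by rewrite ler_nat; lia.
rewrite sumr_const_nat subSS expnS mul2n -addnn addnK -[X in X <= _]mulr_natl divff // pnatr_eq0; lia.
Qed.

Lemma sum_count_mul n m M : (0 < m)%N ->
  \sum_(1 <= c < n.+1) ((m * c <= M)%N)%:R <= M%:R / m%:R :> R.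
Proof.
move=> m0; rewrite -natr_sum ler_pdivlMr ?ltr0n // -natrM ler_nat.
apply: leq_trans (leq_divM M m); rewrite leq_mul2r; apply/orP; right.
rewrite (eq_bigr (fun c => (c <= M %/ m : nat)%N)); last first.
  by move=> c _; rewrite leq_divRL // mulnC.
elim: n => [|n IH]; first by rewrite big_geq.
rewrite big_nat_recr //=; case: (leqP n.+1) => h; last by rewrite addn0.
rewrite addn1; apply: leq_ltn_trans h.
rewrite -[X in (_ <= X)%N](_ : \sum_(1 <= c < n.+1) 1 = n)%N; last by rewrite sum_nat_const_nat; lia.
by apply: leq_sum => i _; exact: leq_b1.
Qed.

Lemma size_filter_sum (T : Type) (a : pred T) (s : seq T) :
  (size [seq x <- s | a x])%:R = \sum_(x <- s) (a x)%:R :> R.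
Proof.
by rewrite size_filter -sum1_count natr_sum big_mkcond; apply: eq_bigr => x _; case: (a x).
Qed.

Lemma size_triples_le M : (size (triples_le M))%:R <= M%:R * harm M ^+ 2 :> R.
Proof.
rewrite size_filter_sum /triples !big_allpairs /prod3 /=.
apply: (@le_trans _ _ (\sum_(1 <= a < M.+1) \sum_(1 <= b < M.+1) M%:R / (a * b)%:R)).
  apply: ler_sum_nat => a /andP [a0 _]; apply: ler_sum_nat => b /andP [b0 _].
  by apply: sum_count_mul; rewrite muln_gt0 a0.
have -> : M%:R * harm M ^+ 2 = harm M * (M%:R * harm M) by ring.
rewrite {1}/harm mulr_suml; apply: ler_sum => a _.
rewrite mulrA /harm mulr_sumr; apply: ler_sum => b _.
by rewrite natrM invfM mulrA [_^-1 * M%:R]mulrC.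
Qed.

(** [W] is the integer part of [M^(2/3)]. *)
Lemma size_small_pairs M : exists2 W : nat, (W ^ 3 <= M ^ 2)%N &
  (size (small_pairs M))%:R <= W%:R * harm M :> R.
Proof.
have ex0 : exists w, (w ^ 3 <= M ^ 2)%N by exists 0%N.
have ub w : (w ^ 3 <= M ^ 2 -> w <= M ^ 2)%N.
  by move=> h; apply: leq_trans h; case: w => // w; rewrite -{1}[w.+1]expn1 leq_pexp2l.
case: (ex_maxnP ex0 ub) => W hW maxW; exists W => //.
rewrite size_filter_sum big_allpairs /harm mulr_sumr.
apply: ler_sum_nat => a /andP [a0 _] /=.
apply: le_trans (sum_count_mul M W a0); apply: ler_sum => b _ /=; rewrite ler_nat.
by case: (boolP (_ ^ 3 <= _)%N) => // /maxW ->.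
Qed.

(** The off-diagonal solutions number at most [M^(8/3)] up to logarithms, so
    the power saving pays for the harmonic sums. *)
Lemma size_equal_sum_prod_le M : (0 < M)%N -> harm M ^+ 15 <= M%:R ->
  (size (equal_sum_prod M))%:R <= 27 * M%:R ^+ 3 :> R.
Proof.
move=> M0 hH; have [W hW sW] := size_small_pairs M.
have := size_equal_sum_prod M; rewrite -(ler_nat R) => /le_trans; apply.
rewrite natrM natrD (natrM _ 2) (natrM _ (_ ^ 2)) !natrX.
have H0 := harm_ge0 M; set H := harm M in hH sW H0 *.
have M0' : 0 < M%:R :> R by rewrite ltr0n.
have WH : W%:R * H ^+ 5 <= M%:R.
  rewrite -(@ler_pXn2r _ 3) ?nnegrE //; last by rewrite mulr_ge0 // exprn_ge0.
  rewrite exprMn -exprM /= [leRHS]exprSr ler_pM ?exprn_ge0 //.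
  by rewrite -!natrX ler_nat.
have st := size_triples_le M.
suff : (size (triples_le M))%:R ^+ 2 * (size (small_pairs M))%:R <= M%:R ^+ 3 :> R by lra.
apply: (@le_trans _ _ ((M%:R * H ^+ 2) ^+ 2 * (W%:R * H))).
  by rewrite ler_pM ?exprn_ge0 // lerXn2r ?nnegrE // mulr_ge0 // exprn_ge0.
rewrite (_ : _ * _ = M%:R ^+ 2 * (W%:R * H ^+ 5)); last by ring.
by rewrite [leRHS]exprSr ler_wpM2l // exprn_ge0.
Qed.

Definition equal_sum_cubes M :=
  [seq p <- [seq (u, v) | u <- triples M, v <- triples M] |
    (sum3 p.1 == sum3 p.2) &&
    (p.1.1.1 ^ 3 + p.1.1.2 ^ 3 + p.1.2 ^ 3 == p.2.1.1 ^ 3 + p.2.1.2 ^ 3 + p.2.2 ^ 3)]%N.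

(** Since [(a + b + c)^3 - a^3 - b^3 - c^3 = 3 (b + c) (a + c) (a + b)], equal
    sums and equal sums of cubes mean that the pairwise sums have equal
    products. *)
Lemma size_equal_sum_cubes M : (size (equal_sum_cubes M) <= size (equal_sum_prod (2 * M)))%N.
Proof.
pose psi (u : nat * nat * nat) := let: (a, b, c) := u in
  ((b + c - a)./2, (a + c - b)./2, (a + b - c)./2)%N.
apply: (@size_surj _ _ _ _ (fun p => (psi p.1, psi p.2))); first exact/filter_uniq/uniq_triple_pairs.
move=> [[[x1 x2] x3] [[y1 y2] y3]]; rewrite mem_filter mem_triple_pairs !mem_triples /sum3 /=.
case/andP => /andP [/eqP S /eqP E] /andP [/and3P [hx1 hx2 hx3] /and3P [hy1 hy2 hy3]].
exists ((x2 + x3, x1 + x3, x1 + x2), (y2 + y3, y1 + y3, y1 + y2))%N; last first.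
  by rewrite /psi /=; congr ((_, _, _), (_, _, _)); lia.
rewrite mem_filter mem_filter mem_triple_pairs !mem_triples /sum3 /prod3 /=; apply/and4P; split.
- apply/eqP; lia.
- apply/eqP.
  have id a b c : ((a + b + c) ^ 3 = a ^ 3 + b ^ 3 + c ^ 3 + 3 * ((b + c) * (a + c) * (a + b)))%N.
    by rewrite !expnS !expn0; ring.
  by have := id x1 x2 x3; have := id y1 y2 y3; rewrite S; lia.
- by apply/and3P; split; lia.
- by apply/and3P; split; lia.
Qed.

End Harmonic.

(** * Additive characters *)

Section Exponentials.
Local Open Scope ring_scope.
Local Open Scope complex_scope.
Variable R : realType.
Implicit Types (x y : R) (w v : R[i]).

Notation nc := (@Normc.normc R).
Notation e := (@e2pi R).
Notation cj := (@conjc R).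

Lemma ncE w : (nc w)%:C = `|w|.
Proof. by case: w => a b; rewrite normc_def. Qed.

Lemma nc_ge0 w : 0 <= nc w.
Proof. by rewrite -lecR ncE; exact: normr_ge0. Qed.

Lemma ncM w v : nc (w * v) = nc w * nc v.
Proof. exact: Normc.normcM. Qed.

Lemma ncX w n : nc (w ^+ n) = nc w ^+ n.
Proof.
elim: n => [|n IH]; first by rewrite !expr0 Normc.normc1.
by rewrite !exprS ncM IH.
Qed.

Lemma nc_le_add w v : nc (w + v) <= nc w + nc v.
Proof. by rewrite -lecR rmorphD /= !ncE ler_normD. Qed.

Lemma ncN w : nc (- w) = nc w.
Proof. by case: w => a b /=; rewrite !sqrrN. Qed.

Lemma nc_sum (I : Type) (r : seq I) (p : pred I) (F : I -> R[i]) :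
  nc (\sum_(i <- r | p i) F i) <= \sum_(i <- r | p i) nc (F i).
Proof.
elim/big_rec2: _ => [|i y w _ h]; first by rewrite Normc.normc0.
by apply: le_trans (nc_le_add _ _) _; rewrite lerD2l.
Qed.

Lemma nc_sqr w : (nc w ^+ 2)%:C = w * cj w.
Proof.
case: w => a b /=; rewrite sqr_sqrtr ?addr_ge0 ?sqr_ge0 //.
by apply/eqP; rewrite eq_complex /=; apply/andP; split; apply/eqP; ring.
Qed.

Lemma ReD w v : complex.Re (w + v) = complex.Re w + complex.Re v.
Proof. by case: w; case: v. Qed.

Lemma Re_sum (I : Type) (r : seq I) (p : pred I) (F : I -> R[i]) :
  complex.Re (\sum_(i <- r | p i) F i) = \sum_(i <- r | p i) complex.Re (F i).
Proof. by apply: (big_morph (@complex.Re R)) => [|] //; exact: ReD. Qed.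

Lemma conj_sum (I : Type) (r : seq I) (p : pred I) (F : I -> R[i]) :
  cj (\sum_(i <- r | p i) F i) = \sum_(i <- r | p i) cj (F i).
Proof. exact: (rmorph_sum (@conjc R)). Qed.

Lemma Re_real_mul x w : complex.Re (x%:C * w) = x * complex.Re w.
Proof. by case: w => a b /=; rewrite mul0r subr0. Qed.

Lemma Re_le_nc w : complex.Re w <= nc w.
Proof.
case: w => a b /=; apply: (le_trans (ler_norm a)).
by rewrite -sqrtr_sqr ler_wsqrtr // lerDl sqr_ge0.
Qed.

Lemma nc_sqrD w v : nc (w + v) ^+ 2 = nc w ^+ 2 + nc v ^+ 2 + 2 * complex.Re (w * cj v).
Proof.
case: w => a b; case: v => c d /=.
by rewrite !sqr_sqrtr ?addr_ge0 ?sqr_ge0 //; ring.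
Qed.

Lemma e_add x y : e (x + y) = e x * e y.
Proof.
rewrite /e2pi mulrDr cosD sinD; apply/eqP; rewrite eq_complex /=.
by apply/andP; split; apply/eqP; ring.
Qed.

Lemma e_opp x : e (- x) = cj (e x).
Proof. by rewrite /e2pi mulrN cosN sinN. Qed.

Lemma e_0 : e 0 = 1.
Proof. by rewrite /e2pi mulr0 cos0 sin0. Qed.

Lemma nc_e x : nc (e x) = 1.
Proof. by rewrite /e2pi /= cos2Dsin2 sqrtr1. Qed.

Lemma e_mulrn x n : e (x * n%:R) = e x ^+ n.
Proof.
elim: n => [|n IH]; first by rewrite mulr0 expr0 e_0.
by rewrite -addn1 natrD mulrDr mulr1 e_add IH exprD expr1.
Qed.

Lemma e_1 : e 1 = 1.
Proof. by rewrite /e2pi mulr1 mulr_natl cos2pi sin2pi. Qed.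

Lemma e_nat n : e n%:R = 1.
Proof. by rewrite -[n%:R]mul1r e_mulrn e_1 expr1n. Qed.

Lemma e_int (z : int) : e z%:~R = 1.
Proof.
case: (intP z) => [|n|n]; rewrite ?mulr0z ?e_0 //; first exact: e_nat.
by rewrite mulrNz e_opp -[_%:~R]/(n.+1%:R) e_nat conjc1.
Qed.

Lemma e_addz x (z : int) : e (x + z%:~R) = e x.
Proof. by rewrite e_add e_int mulr1. Qed.

Lemma nc_e_sub1 x : nc (e x - 1) = 2 * `|sin (pi * x)|.
Proof.
have -> : e x - 1 = Complex (cos ((pi * x) *+ 2) - 1) (sin ((pi * x) *+ 2)).
  have <- : 2 * pi * x = (pi * x) *+ 2 by rewrite -[RHS]mulr_natl; ring.
  by apply/eqP; rewrite eq_complex /= oppr0 addr0 !eqxx.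
rewrite cos_mulr2n sin_mulr2n /=.
have -> : (cos (pi * x) ^+ 2 *+ 2 - 1 - 1) ^+ 2 + (cos (pi * x) * sin (pi * x) *+ 2) ^+ 2
   = (2 * sin (pi * x)) ^+ 2.
  have h := cos2Dsin2 (pi * x).
  have -> : cos (pi * x) ^+ 2 *+ 2 - 1 - 1 = - 2 * sin (pi * x) ^+ 2 by rewrite -[X in _ - X - X]h; ring.
  have -> : (-2 * sin (pi * x) ^+ 2) ^+ 2 + (cos (pi * x) * sin (pi * x) *+ 2) ^+ 2 =
     (2 * sin (pi * x)) ^+ 2 * (cos (pi * x) ^+ 2 + sin (pi * x) ^+ 2) by ring.
  by rewrite h mulr1.
by rewrite sqrtr_sqr normrM ger0_norm.
Qed.

Lemma sin_MVT x : 0 < x -> exists2 c : R, 0 < c < x & sin x = cos c * x.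
Proof.
move=> x0.
case: (@MVT R (@sin R) (@cos R) 0 x x0 (fun y _ => is_derive_sin y)) => [|c].
  exact/continuous_subspaceT/continuous_sin.
by rewrite in_itv /= => cx; rewrite sin0 !subr0 => ->; exists c.
Qed.

Lemma sin_le x : 0 <= x -> sin x <= x.
Proof.
rewrite le_eqVlt => /predU1P [<-|x0]; first by rewrite sin0.
have [c _ ->] := sin_MVT x0; rewrite -[leRHS]mul1r ler_wpM2r ?cos_le1 //; exact: ltW.
Qed.

Lemma norm_sin_le x : `|sin x| <= `|x|.
Proof.
wlog x0 : x / 0 <= x.
  move=> H; case: (leP 0 x) => [/H //|x0].
  by rewrite -normrN -sinN -[leRHS]normrN; apply: H; lra.
rewrite (ger0_norm x0) ler_norml sin_le // andbT.
case: (leP x pi) => xp; first by have := @sin_ge0_pi R x; rewrite x0 xp => /(_ isT); lra.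
by have := @pi_ge2 R; have := sin_geN1 x; lra.
Qed.

Lemma nc_e_sub1_le x : nc (e x - 1) <= 2 * pi * `|x|.
Proof.
rewrite nc_e_sub1 -mulrA ler_wpM2l //.
by apply: le_trans (norm_sin_le _) _; rewrite normrM (ger0_norm (pi_ge0 R)).
Qed.

(** By the mean value theorem [sin (x / 2) >= cos (x / 2) (x / 2)], and [2 cos
    (x / 2)^2 >= 1] on this range. *)
Lemma sin_ge x : 0 <= x <= pi / 2 -> x / 2 <= sin x.
Proof.
case/andP; rewrite le_eqVlt => /predU1P [<- _|x0 xp]; first by rewrite mul0r sin0.
have y0 : 0 < x / 2 by lra.
have [c /andP [c0 cx] sc] := sin_MVT y0.
have cosy : 0 <= cos (x / 2) by apply: cos_ge0_pihalf; have := pi_ge0 R; lra.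
have cosle : cos (x / 2) <= cos c.
  by rewrite ltW // ltr_cos ?in_itv /=; have := @pi_ge2 R; lra.
have cosx : 0 <= cos x by apply: cos_ge0_pihalf; have := pi_ge0 R; lra.
have ex : x = (x / 2) *+ 2 by rewrite -mulr_natr; field.
have c2 : 1 <= 2 * cos (x / 2) ^+ 2.
  by move: cosx; rewrite {1}ex cos_mulr2n; rewrite -mulr_natl; lra.
have : cos (x / 2) ^+ 2 <= cos (x / 2) * cos c by rewrite expr2 ler_wpM2l.
have -> : sin x = (2 * (cos (x / 2) * cos c)) * (x / 2) by rewrite {1}ex sin_mulr2n sc; ring.
by move=> h; apply: ler_peMl; lra.
Qed.

Lemma nc_e_sub1_ge x : `|x| <= 1 / 2 -> 2 * `|x| <= nc (e x - 1).
Proof.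
move=> hx; rewrite nc_e_sub1 ler_wpM2l //.
have hp := @pi_ge2 R.
have -> : `|sin (pi * x)| = `|sin (pi * `|x|)|.
  by case: (ger0P x) => h //; rewrite mulrN sinN normrN.
apply: le_trans (ler_norm _).
have : pi * `|x| / 2 <= sin (pi * `|x|).
  apply: sin_ge; have := normr_ge0 x; nra.
have := normr_ge0 x; nra.
Qed.

Lemma geom_sum_le x n : nc (\sum_(1 <= i < n.+1) e (x * i%:R)) * nc (e x - 1) <= 2.
Proof.
rewrite -ncM.
have -> : \sum_(1 <= i < n.+1) e (x * i%:R) = e x * \sum_(i < n) e x ^+ i.
  rewrite big_add1 big_mkord mulr_sumr; apply: eq_bigr => i _.
  by rewrite e_mulrn exprS.
rewrite -mulrA [X in _ * X]mulrC -subrX1 ncM nc_e mul1r.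
by apply: le_trans (nc_le_add _ _) _; rewrite ncN ncX nc_e expr1n Normc.normc1.
Qed.

Lemma geom_sum_dist x (z : int) n : `|x - z%:~R| <= 1 / 2 ->
  nc (\sum_(1 <= i < n.+1) e (x * i%:R)) * `|x - z%:~R| <= 1.
Proof.
move=> h; have := geom_sum_le x n.
have -> : e x = e (x - z%:~R) by rewrite -[in LHS](subrK z%:~R x) e_addz.
have := nc_e_sub1_ge h.
set S := nc (\sum_(_ <= _ < _) _) => h1 h2.
by have := ler_wpM2l (nc_ge0 (\sum_(1 <= i < n.+1) e (x * i%:R))) h1; rewrite -/S; lra.
Qed.

Lemma nearest x : exists z : int, `|x - z%:~R| <= 1 / 2.
Proof.
exists (Num.floor (x + 1 / 2)).
have /andP [] := Num.Theory.floor_itv (x + 1 / 2); rewrite intrD ler_norml.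
by move=> h1 h2; apply/andP; split; lra.
Qed.

Lemma e_orth N (m n : nat) : (m < N)%N -> (n < N)%N ->
  \sum_(i < N) e (i%:R / N%:R * m%:R) * cj (e (i%:R / N%:R * n%:R)) =
  (N%:R * (m == n)%:R)%:C.
Proof.
move=> mN nN; have N0 : (0 < N)%N by exact: leq_ltn_trans mN.
have Nn0 : (N%:R : R) != 0 by rewrite pnatr_eq0; lia.
pose w := e ((m%:R - n%:R) / N%:R).
rewrite (eq_bigr (fun i : 'I_N => w ^+ i)); last first.
  move=> i _; rewrite -e_opp -e_add /w -e_mulrn; congr e; by field.
have [mn|mn] := eqVneq m n.
  rewrite mulr1 (eq_bigr (fun=> 1)); last by move=> i _; rewrite /w mn subrr mul0r e_0 expr1n.
  by rewrite sumr_const card_ord rmorph_nat.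
rewrite mulr0; apply/eqP; rewrite -[_ == _]/(_ == 0 :> R[i]).
have wN : w ^+ N = 1.
  rewrite /w -e_mulrn divfK // -[m%:R]/(m%:Z%:~R) -[n%:R]/(n%:Z%:~R) -intrB; exact: e_int.
have w1 : w - 1 != 0.
  apply/eqP => w1; have := nc_e_sub1 ((m%:R - n%:R) / N%:R).
  rewrite -/w w1 Normc.normc0 => /esym/eqP; rewrite mulf_eq0 pnatr_eq0 /= normr_eq0 => s0.
  have pp := @pi_gt0 R.
  have N0' : 0 < (N%:R : R) by rewrite ltr0n.
  case: (ltngtP m n) mn => // mn _.
    have : 0 < sin (pi * ((n%:R - m%:R) / N%:R : R)).
      apply: sin_gt0_pi; rewrite mulr_gt0 //=; last by rewrite divr_gt0 // subr_gt0 ltr_nat.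
      rewrite -[ltRHS]mulr1 ltr_pM2l // ltr_pdivrMr // mul1r.
      by rewrite ltrBlDr -natrD ltr_nat; lia.
    by rewrite -opprB mulNr mulrN sinN (eqP s0) oppr0 ltxx.
  have : 0 < sin (pi * ((m%:R - n%:R) / N%:R : R)).
    apply: sin_gt0_pi; rewrite mulr_gt0 //=; last by rewrite divr_gt0 // subr_gt0 ltr_nat.
    rewrite -[ltRHS]mulr1 ltr_pM2l // ltr_pdivrMr // mul1r.
    by rewrite ltrBlDr -natrD ltr_nat; lia.
  by rewrite (eqP s0) ltxx.
have : (w - 1) * (\sum_(i < N) w ^+ i) = 0 by rewrite -subrX1 wN subrr.
by move/eqP; rewrite mulf_eq0 (negPf w1).
Qed.

Lemma parseval (T : eqType) (s : seq T) (c : T -> R[i]) (f : T -> nat) N :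
  (forall t, t \in s -> (f t < N)%N) ->
  N%:R^-1 * \sum_(i < N) nc (\sum_(t <- s) c t * e (i%:R / N%:R * (f t)%:R)) ^+ 2 =
  \sum_(t <- s) \sum_(u <- s) (f t == f u)%:R * complex.Re (c t * cj (c u)).
Proof.
move=> fN.
have [N0|N0] := posnP N; last first.
  have Nn0 : (N%:R : R) != 0 by rewrite pnatr_eq0; lia.
  apply: (mulfI Nn0); rewrite mulrA divff // mul1r.
  transitivity (complex.Re (\sum_(i < N) \sum_(t <- s) \sum_(u <- s)
     (c t * cj (c u)) * (e (i%:R / N%:R * (f t)%:R) * cj (e (i%:R / N%:R * (f u)%:R))))).
    rewrite Re_sum; apply: eq_bigr => i _.
    have -> : nc (\sum_(t <- s) c t * e (i%:R / N%:R * (f t)%:R)) ^+ 2 =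
      complex.Re (nc (\sum_(t <- s) c t * e (i%:R / N%:R * (f t)%:R)) ^+ 2)%:C by [].
    rewrite nc_sqr conj_sum mulr_suml; congr complex.Re; apply: eq_bigr => t _.
    by rewrite mulr_sumr; apply: eq_bigr => u _; rewrite rmorphM /= mulrACA.
  rewrite exchange_big Re_sum mulr_sumr; apply: eq_big_seq => t /fN ft.
  rewrite exchange_big Re_sum mulr_sumr; apply: eq_big_seq => u /fN fu.
  by rewrite -mulr_sumr e_orth // mulrC Re_real_mul mulrA.
case: s fN => [|t s] fN; first by rewrite N0 big_ord0 mulr0 big_nil.
by have := fN t (mem_head _ _); rewrite N0.
Qed.

Lemma parseval_count (T : eqType) (s : seq T) (f : T -> nat) N :
  (forall t, t \in s -> (f t < N)%N) ->
  N%:R^-1 * \sum_(i < N) nc (\sum_(t <- s) e (i%:R / N%:R * (f t)%:R)) ^+ 2 =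
  (size [seq p <- [seq (t, u) | t <- s, u <- s] | f p.1 == f p.2])%:R.
Proof.
move=> fN; have := @parseval _ s (fun=> 1) _ _ fN.
under eq_bigr do under eq_bigr do rewrite mul1r.
move=> ->; rewrite size_filter_sum big_allpairs; apply: eq_bigr => t _; apply: eq_bigr => u _.
by rewrite conjc1 mulr1 /= mulr1.
Qed.

(** The square of a sum, with its off-diagonal terms grouped by the shift [k].
    Applied to a polynomial phase it lowers the degree by one. *)
Lemma van_der_corput (w : nat -> R[i]) M :
  nc (\sum_(1 <= x < M.+1) w x) ^+ 2 =
  \sum_(1 <= x < M.+1) nc (w x) ^+ 2 +
  2 * \sum_(1 <= k < M) complex.Re (\sum_(1 <= x < (M - k).+1) w (x + k)%N * cj (w x)).
Proof.
elim: M => [|M IH]; first by rewrite !big_geq // Normc.normc0 expr0n mulr0 addr0.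
rewrite big_nat_recr //= nc_sqrD IH [in RHS]big_nat_recr //=.
rewrite -!addrA; congr (_ + _); rewrite [_ + (nc _ ^+ 2 + _)]addrCA; congr (_ + _).
rewrite -mulrDr; congr (_ * _).
have -> : \sum_(1 <= k < M.+1) complex.Re (\sum_(1 <= x < (M.+1 - k).+1) w (x + k)%N * cj (w x))
  = \sum_(1 <= k < M.+1) complex.Re (\sum_(1 <= x < (M - k).+1) w (x + k)%N * cj (w x)) +
    \sum_(1 <= k < M.+1) complex.Re (w M.+1 * cj (w (M.+1 - k)%N)).
  rewrite -big_split /=; apply: eq_big_nat => k /andP [k1 kM].
  rewrite subSn // [in LHS]big_nat_recr //= ReD; congr (_ + _); congr (complex.Re (w _ * _)); lia.
congr (_ + _).
  case: M {IH} => [|M]; first by rewrite !big_geq.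
  by rewrite [in RHS]big_nat_recr //= subnn [X in _ + complex.Re X]big_geq // addr0.
have -> : (\sum_(1 <= x < M.+1) w x) * cj (w M.+1) = cj (w M.+1 * cj (\sum_(1 <= x < M.+1) w x)).
  by rewrite rmorphM /= conjcK mulrC.
have Rec v : complex.Re (cj v) = complex.Re v by case: v.
rewrite Rec conj_sum mulr_sumr Re_sum big_nat_rev /=.
by apply: eq_big_nat => k /andP [k1 kM]; rewrite add1n subSS.
Qed.

End Exponentials.

(** * Cubic sums and their moments *)

Section CubicSums.
Local Open Scope ring_scope.
Local Open Scope complex_scope.
Variable R : realType.
Implicit Types (a b : R).

Notation nc := (@Normc.normc R).
Notation e := (@e2pi R).
Notation cj := (@conjc R).

Definition cubic_sum (P : nat) a b : R[i] :=
  \sum_(1 <= x < P.+1) e (a * x%:R + b * x%:R ^+ 3).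

(** The mean runs over the points [i / N] instead of the unit interval; for
    even [k] and large [N] the two agree. *)
Definition moment N k P b : R := N%:R^-1 * \sum_(i < N) nc (cubic_sum P (i%:R / N%:R) b) ^+ k.

(** Up to symmetry, the terms of the fourth moment with [x1 + x2 = x3 + x4]
    and nonzero [h = x1 - x3], [k = x3 - x2]: with [x = x2], their frequency
    [x1^3 + x2^3 - x3^3 - x4^3] factors as [3 h k (2 x + h + k)]. *)
Definition offdiag P b : R[i] :=
  \sum_(1 <= h < P) \sum_(1 <= k < P - h) \sum_(1 <= x < (P - h - k).+1)
    e (b * (3 * (h * k * (2 * x + h + k)))%:R).

Lemma sum_cst (x : R) m n : \sum_(m <= i < n) x = (n - m)%:R * x.
Proof. by rewrite sumr_const_nat mulr_natl. Qed.

Lemma nc_cubic_sum_le P a b : nc (cubic_sum P a b) <= P%:R.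
Proof.
apply: le_trans (nc_sum _ _ _) _; rewrite (eq_bigr (fun=> 1)) => [|i _]; last exact: nc_e.
by rewrite sum_cst subn1 mulr1.
Qed.

Lemma moment_ge0 N k P b : 0 <= moment N k P b.
Proof. by rewrite mulr_ge0 ?invr_ge0 // sumr_ge0 // => i _; rewrite exprn_ge0 // nc_ge0. Qed.

(** These are the Fourier coefficients of [|f|^2] in the first variable; their
    phases are quadratic in [x]. *)
Let diff_sum P b h : R[i] :=
  \sum_(1 <= x < (P - h).+1) e (b * ((x + h)%:R ^+ 3 - x%:R ^+ 3)).

Let nc_cubic_sum_sqr P a b : nc (cubic_sum P a b) ^+ 2 =
  P%:R + 2 * complex.Re (\sum_(h <- index_iota 1 P) diff_sum P b h * e (a * h%:R)).
Proof.
rewrite /cubic_sum van_der_corput; congr (_ + 2 * _).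
  by rewrite (eq_bigr (fun=> 1)) => [|i _]; rewrite ?nc_e ?expr1n // sum_cst subn1 mulr1.
rewrite Re_sum; apply: eq_bigr => h _; congr complex.Re.
rewrite /diff_sum mulr_suml; apply: eq_bigr => x _.
by rewrite -e_opp -!e_add; congr e; rewrite natrD; ring.
Qed.

Let sum_diff_sum P b : \sum_(h <- index_iota 1 P) nc (diff_sum P b h) ^+ 2 <=
   P%:R ^+ 2 + 2 * nc (offdiag P b).
Proof.
have E h : nc (diff_sum P b h) ^+ 2 = (P - h)%:R + 2 * complex.Re (\sum_(1 <= k < P - h)
    \sum_(1 <= x < (P - h - k).+1) e (b * (3 * (h * k * (2 * x + h + k)))%:R)).
  rewrite /diff_sum van_der_corput; congr (_ + 2 * _).
    by rewrite (eq_bigr (fun=> 1)) => [|i _]; rewrite ?nc_e ?expr1n // sum_cst subn1 mulr1.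
  rewrite Re_sum; apply: eq_bigr => k _; congr complex.Re; apply: eq_bigr => x _.
  by rewrite -e_opp -e_add; congr e; rewrite !(natrM, natrD); ring.
rewrite (eq_bigr _ (fun h _ => E h)) big_split /= -mulr_sumr -Re_sum.
apply: lerD; last by rewrite ler_wpM2l //; exact: Re_le_nc.
apply: (@le_trans _ _ (\sum_(1 <= h < P) P%:R)).
  by apply: ler_sum => h _; rewrite ler_nat leq_subr.
by rewrite sum_cst expr2 ler_wpM2r // ler_nat leq_subr.
Qed.

(** Write [|f|^2 = P + 2 Re Z]. The crude bound [2 P^2 + 8 |Z|^2] for its
    square costs only a constant factor on the diagonal, and orthogonality
    turns the mean of [|Z|^2] into the squares of the [diff_sum]. *)
Lemma fourth_moment_le N P b : (P < N)%N ->
  moment N 4 P b <= 10 * P%:R ^+ 2 + 16 * nc (offdiag P b).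
Proof.
move=> PN; have N0 : (0 < N)%N by lia.
pose Z i := \sum_(h <- index_iota 1 P) diff_sum P b h * e (i%:R / N%:R * h%:R).
have le4 (i : 'I_N) : nc (cubic_sum P (i%:R / N%:R) b) ^+ 4 <= 2 * P%:R ^+ 2 + 8 * nc (Z i) ^+ 2.
  rewrite -[4%N]/(2 * 2)%N exprM nc_cubic_sum_sqr -/(Z i).
  have : complex.Re (Z i) ^+ 2 <= nc (Z i) ^+ 2.
    case: (Z i) => x y /=; rewrite sqr_sqrtr ?addr_ge0 ?sqr_ge0 //.
    by rewrite lerDl sqr_ge0.
  have := sqr_ge0 (P%:R - 2 * complex.Re (Z i)); lra.
have Nn0 : (N%:R : R) != 0 by rewrite pnatr_eq0; lia.
have pv : N%:R^-1 * \sum_(i < N) nc (Z i) ^+ 2 = \sum_(h <- index_iota 1 P) nc (diff_sum P b h) ^+ 2.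
  rewrite (@parseval R _ (index_iota 1 P) (diff_sum P b) id N); last first.
    by move=> h; rewrite mem_index_iota; lia.
  apply: eq_big_seq => h hP; rewrite (bigD1_seq h) ?iota_uniq //= eqxx mul1r big1 ?addr0.
    by rewrite -nc_sqr.
  by move=> k /negPf kh; rewrite eq_sym kh mul0r.
apply: (@le_trans _ _ (N%:R^-1 * \sum_(i < N) (2 * P%:R ^+ 2 + 8 * nc (Z i) ^+ 2))).
  by rewrite ler_wpM2l ?invr_ge0 //; apply: ler_sum => i _.
have -> : N%:R^-1 * \sum_(i < N) (2 * P%:R ^+ 2 + 8 * nc (Z i) ^+ 2) =
    2 * P%:R ^+ 2 + 8 * (N%:R^-1 * \sum_(i < N) nc (Z i) ^+ 2).
  by rewrite big_split /= -mulr_sumr sumr_const card_ord -mulr_sumr -[_ *+ N]mulr_natl; field.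
by rewrite pv; have := sum_diff_sum P b; lra.
Qed.

Lemma cubic_sum_period P a b : cubic_sum P (a + 1) b = cubic_sum P a b.
Proof.
apply: eq_bigr => x _.
by rewrite mulrDl mul1r addrAC e_add e_nat mulr1.
Qed.

Lemma cubic_sum_lipschitz P a a' b b' :
  nc (cubic_sum P a' b') <= nc (cubic_sum P a b) + 8 * (P%:R ^+ 2 * `|a' - a| + P%:R ^+ 4 * `|b' - b|).
Proof.
have -> : cubic_sum P a' b' = cubic_sum P a b + (cubic_sum P a' b' - cubic_sum P a b) by rewrite addrC subrK.
apply: le_trans (nc_le_add _ _) _; rewrite lerD2l /cubic_sum -sumrB.
apply: le_trans (nc_sum _ _ _) _.
apply: (@le_trans _ _ (\sum_(1 <= x < P.+1) 8 * (P%:R * `|a' - a| + P%:R ^+ 3 * `|b' - b|))).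
  apply: ler_sum_nat => x /andP [_ xP].
  have -> : e (a' * x%:R + b' * x%:R ^+ 3) - e (a * x%:R + b * x%:R ^+ 3) =
     e (a * x%:R + b * x%:R ^+ 3) * (e ((a' - a) * x%:R + (b' - b) * x%:R ^+ 3) - 1).
    by rewrite mulrBr mulr1 -e_add; congr (e _ - _); ring.
  rewrite ncM nc_e mul1r; apply: le_trans (nc_e_sub1_le _) _.
  have p8 : 2 * pi <= 8 :> R by have := @pihalf_lt2 R; lra.
  apply: ler_pM => //; first by rewrite mulr_ge0 ?pi_ge0.
  apply: le_trans (ler_normD _ _) _; rewrite normrM normr_nat normrM normrX normr_nat.
  have xP' : x%:R <= P%:R :> R by rewrite ler_nat.
  by apply: lerD; rewrite mulrC ler_wpM2r // lerXn2r ?nnegrE.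
by rewrite sum_cst subn1 /= le_eqVlt; apply/orP; left; apply/eqP; ring.
Qed.

(** If [|f|] takes the value [s] at some point, it stays above [s / 2] on an
    interval of length [s / (32 P^2)] around it. *)
Lemma sup_le_fourth N P b (i0 : 'I_N) : (0 < P)%N ->
  nc (cubic_sum P (i0%:R / N%:R) b) ^+ 5 <= 2 ^+ 9 * P%:R ^+ 2 * moment N 4 P b.
Proof.
case: N i0 => [[] // | N] i0 P0; set s := nc _.
have s0 : 0 <= s by exact: nc_ge0.
have sP : s <= P%:R by exact: nc_cubic_sum_le.
have P1 : 1 <= P%:R :> R by rewrite ler1n.
have N0 : 0 < (N.+1%:R : R) by rewrite ltr0n.
have shift : moment N.+1 4 P b =
    N.+1%:R^-1 * \sum_(i < N.+1) nc (cubic_sum P (i0%:R / N.+1%:R + i%:R / N.+1%:R) b) ^+ 4.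
  congr (_ * _); rewrite (reindex_inj (addrI i0)) /=; apply: eq_bigr => i _; congr (nc _ ^+ _).
  have := divn_eq (i0 + i) N.+1.
  have : ((i0 + i) %/ N.+1 < 2)%N by rewrite ltn_divLR //; have := ltn_ord i0; have := ltn_ord i; lia.
  rewrite -mulrDl -natrD; case: (_ %/ _)%N => [|[|//]] _ eq.
    by rewrite {2}eq mul0n add0n.
  by rewrite {2}eq mul1n natrD mulrDl divff ?gt_eqF // [1 + _]addrC cubic_sum_period.
have P2 : 0 < P%:R ^+ 2 :> R by rewrite exprn_gt0 // ltr0n.
pose y := s * N.+1%:R / (32 * P%:R ^+ 2).
have y0 : 0 <= y by rewrite divr_ge0 ?mulr_ge0 // ?exprn_ge0.
pose D := Num.truncn y.
have /andP [Dy yD] := Num.Theory.truncn_itv y0.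
have y1 : y <= N.+1%:R / 32.
  rewrite /y ler_pdivrMr; last by lra.
  have -> : N.+1%:R / 32 * (32 * P%:R ^+ 2) = P%:R ^+ 2 * N.+1%:R :> R by field.
  by rewrite ler_wpM2r // (le_trans sP) // expr2 ler_peMl.
have DN : (D < N.+1)%N.
  by rewrite -(ltr_nat R); apply: le_lt_trans (le_trans Dy y1) _; rewrite ltr_pdivrMr //; lra.
rewrite shift.
apply: (@le_trans _ _ (2 ^+ 9 * P%:R ^+ 2 * (N.+1%:R^-1 * (D.+1%:R * (s / 2) ^+ 4)))).
  have : s / (32 * P%:R ^+ 2) <= N.+1%:R^-1 * D.+1%:R.
    rewrite [leRHS]mulrC ler_pdivlMr // mulrAC; exact: ltW.
  have e0 : 0 <= 2 ^+ 9 * P%:R ^+ 2 * (s / 2) ^+ 4 :> R by rewrite !mulr_ge0 // exprn_ge0 // divr_ge0.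
  move=> h; have := ler_wpM2l e0 h.
  have -> : 2 ^+ 9 * P%:R ^+ 2 * (s / 2) ^+ 4 * (s / (32 * P%:R ^+ 2)) = s ^+ 5.
    field; lra.
  by move=> h'; apply: le_trans h' _; rewrite le_eqVlt; apply/orP; left; apply/eqP; ring.
rewrite ler_wpM2l ?mulr_ge0 ?exprn_ge0 // ler_wpM2l ?invr_ge0 //.
have -> : D.+1%:R * (s / 2) ^+ 4 = \sum_(i < D.+1) (s / 2) ^+ 4.
  by rewrite sumr_const card_ord mulr_natl.
rewrite (big_ord_widen N.+1 (fun=> (s / 2) ^+ 4)) // big_mkcond /=.
apply: ler_sum => i _; case: ifP => iD; last by rewrite exprn_ge0 // nc_ge0.
rewrite lerXn2r ?nnegrE ?divr_ge0 ?nc_ge0 //.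
have := cubic_sum_lipschitz P (i0%:R / N.+1%:R + i%:R / N.+1%:R) (i0%:R / N.+1%:R) b b.
rewrite -/s subrr normr0 mulr0 addr0 [8 * (_ * _)]mulrA.
rewrite opprD addNKr normrN ger0_norm ?divr_ge0 // => h.
have : i%:R / N.+1%:R <= s / (32 * P%:R ^+ 2) :> R.
  rewrite ler_pdivrMr // mulrAC; apply: le_trans Dy; rewrite ler_nat; lia.
have e0 : 0 <= 8 * P%:R ^+ 2 :> R by rewrite mulr_ge0 // exprn_ge0.
move=> h'; have := ler_wpM2l e0 h'.
have -> : 8 * P%:R ^+ 2 * (s / (32 * P%:R ^+ 2)) = 8 / 32 * s by field; lra.
have aux (r u v : R) : 0 <= r -> r <= u + v -> v <= 8 / 32 * r -> r / 2 <= u by lra.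
exact: aux s0 h.
Qed.

Let offdiag_index P : seq (nat * nat * nat) := [seq (hk, x) |
  hk <- [seq (h, k) | h <- index_iota 1 P, k <- index_iota 1 (P - h)],
  x <- index_iota 1 (P - hk.1 - hk.2).+1].

Let mem_offdiag_index P h k x : ((h, k, x) \in offdiag_index P) = [&& 0 < h, 0 < k, 0 < x & h + k + x <= P]%N.
Proof.
apply/allpairsPdep/and4P => [[[h' k'] [x' [/allpairsPdep [h1 [k1 [+ + [-> ->]]]] + [-> -> ->]]]]|].
  by rewrite !mem_index_iota /= => ? ? ?; split; lia.
case=> h0 k0 x0 hkx; exists (h, k), x; split => //; last by rewrite mem_index_iota /=; lia.
by apply/allpairsPdep; exists h, k; rewrite !mem_index_iota; split => //; lia.
Qed.

Let uniq_offdiag_index P : uniq (offdiag_index P).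
Proof.
apply: allpairs_uniq_dep => [|x _|[a x] [b y] _ _ /= [-> ->]] //; last exact: iota_uniq.
by apply: allpairs_uniq_dep => [|x _|[a x] [b y] _ _ /= [-> ->]] //; exact: iota_uniq.
Qed.

(** By orthogonality this counts solutions of [h k m = h' k' m'] with [m = 2 x
    + h + k]. *)
Lemma second_moment_offdiag N P : (6 * P ^ 3 < N)%N ->
  N%:R^-1 * \sum_(j < N) nc (offdiag P (j%:R / N%:R)) ^+ 2 <= (size (triples_le (2 * P)))%:R ^+ 3.
Proof.
move=> PN.
pose f (t : nat * nat * nat) := (3 * (t.1.1 * t.1.2 * (2 * t.2 + t.1.1 + t.1.2)))%N.
have E b : offdiag P b = \sum_(t <- offdiag_index P) e (b * (f t)%:R).
  by rewrite /offdiag /offdiag_index big_allpairs_dep big_allpairs_dep.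
under eq_bigr do rewrite E.
rewrite (@parseval_count R _ (offdiag_index P) f) -?natrX ?ler_nat; last first.
  move=> [[h k] x]; rewrite mem_offdiag_index /f /= => /and4P [h0 k0 x0 hkx].
  apply: leq_ltn_trans PN.
  have : (h * k <= P * P)%N by apply: leq_mul; lia.
  move=> hk; have := leq_mul hk (_ : 2 * x + h + k <= 2 * P)%N; rewrite !expnS expn0; lia.
apply: leq_trans (size_equal_prod _).
pose g (t : nat * nat * nat) : nat * nat * nat := (t.1, (t.2 - t.1.1 - t.1.2)./2).
apply: (@size_surj _ _ _ _ (fun p => (g p.1, g p.2))).
  by apply/filter_uniq/allpairs_uniq; rewrite ?uniq_offdiag_index // => -[? ?] [? ?] _ _ [-> ->].
move=> [[[h k] x] [[h' k'] x']]; rewrite mem_filter => /andP [/eqP fe] /allpairsP [[t u]] /= [+ + [E1 E2]].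
rewrite -E1 -E2 !mem_offdiag_index => /and4P [h0 k0 x0 hkx] /and4P [h0' k0' x0' hkx'].
exists ((h, k, 2 * x + h + k), (h', k', 2 * x' + h' + k'))%N; last first.
  by rewrite /g /=; congr ((_, _), (_, _)); lia.
rewrite mem_filter mem_triple_pairs !mem_triples /prod3 /=; apply/and3P; split.
- by move: fe; rewrite /f /= => /eqP; rewrite eqn_pmul2l.
- by apply/and3P; split; lia.
- by apply/and3P; split; lia.
Qed.

Lemma sixth_moment N P : (3 * P ^ 3 < N)%N ->
  N%:R^-1 * \sum_(j < N) moment N 6 P (j%:R / N%:R) = (size (equal_sum_cubes P))%:R.
Proof.
move=> PN.
pose ka (t : nat * nat * nat) := (t.1.1 ^ 3 + t.1.2 ^ 3 + t.2 ^ 3)%N.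
have E a b : nc (cubic_sum P a b) ^+ 6 =
    nc (\sum_(t <- triples P) e (b * (ka t)%:R) * e (a * (sum3 t)%:R)) ^+ 2.
  rewrite -[6%N]/(3 * 2)%N exprM -ncX; congr (nc _ ^+ 2).
  rewrite /triples !big_allpairs /= !exprS expr0 mulr1 {1}/cubic_sum mulr_suml; apply: eq_bigr => x _.
  rewrite {1}/cubic_sum mulr_suml mulr_sumr; apply: eq_bigr => y _.
  rewrite /cubic_sum !mulr_sumr; apply: eq_bigr => z _.
  by rewrite /ka /sum3 /= -!e_add; congr e; rewrite !(natrD, natrX); ring.
have bd t : t \in triples P -> (sum3 t < N)%N /\ (ka t < N)%N.
  case: t => [[x y] z]; rewrite mem_triples /sum3 /ka /= => /and3P [/andP [_ hx] /andP [_ hy] /andP [_ hz]].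
  have := leq_exp2r x P (isT : 0 < 3)%N; have := leq_exp2r y P (isT : 0 < 3)%N.
  have := leq_exp2r z P (isT : 0 < 3)%N; rewrite hx hy hz => lz ly lx.
  have : (P <= P ^ 3)%N by case: (P) => // p; rewrite -{1}[p.+1]expn1 leq_pexp2l.
  by split; lia.
have mom b : moment N 6 P b = \sum_(t <- triples P) \sum_(u <- triples P)
   (sum3 t == sum3 u)%:R * complex.Re (e (b * (ka t)%:R) * cj (e (b * (ka u)%:R))).
  rewrite /moment; under eq_bigr do rewrite E.
  by apply: parseval => t /bd [].
under eq_bigr do rewrite mom.
rewrite exchange_big mulr_sumr /equal_sum_cubes [in RHS]size_filter_sum [in RHS]big_allpairs.
apply: eq_big_seq => t /bd [_ kt]; rewrite exchange_big mulr_sumr.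
apply: eq_big_seq => u /bd [_ ku]; rewrite -mulr_sumr -Re_sum e_orth //=.
have N0 : (N%:R : R) != 0 by rewrite pnatr_eq0; lia.
by rewrite -mulnb natrM mulrCA mulKf.
Qed.

(** Up to a phase, the inner sum of [offdiag] at [c = 6 b]. *)
Definition linear_sum P c h k : R := nc (\sum_(1 <= x < (P - h - k).+1) e (c * (h * k)%:R * x%:R)).

Lemma offdiag_le P b : nc (offdiag P b) <= \sum_(1 <= h < P) \sum_(1 <= k < P) linear_sum P (6 * b) h k.
Proof.
apply: le_trans (nc_sum _ _ _) _; apply: ler_sum_nat => h /andP [h0 hP].
apply: le_trans (nc_sum _ _ _) _.
rewrite [leRHS](@big_cat_nat _ _ _ (P - h)%N) //=; [|lia|lia].
apply: ler_wpDr; first by apply: sumr_ge0 => k _; exact: nc_ge0.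
apply: ler_sum_nat => k /andP [k0 kP].
rewrite le_eqVlt; apply/orP; left; apply/eqP.
transitivity (nc (e (b * (3 * (h * k * (h + k)))%:R) *
    \sum_(1 <= x < (P - h - k).+1) e (6 * b * (h * k)%:R * x%:R))); last first.
  by rewrite ncM nc_e mul1r.
rewrite mulr_sumr; congr nc; apply: eq_bigr => x _; rewrite -e_add; congr e.
by rewrite !(natrM, natrD); ring.
Qed.

Lemma linear_sum_le P c h k : linear_sum P c h k <= P%:R.
Proof.
apply: le_trans (nc_sum _ _ _) _; rewrite (eq_bigr (fun=> 1)) => [|i _]; last exact: nc_e.
by rewrite sum_cst mulr1 ler_nat; lia.
Qed.

Lemma linear_sum_ge0 P c h k : 0 <= linear_sum P c h k.
Proof. exact: nc_ge0. Qed.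

Lemma linear_sum_dist P c h k (z : int) : `|c * (h * k)%:R - z%:~R| <= 1 / 2 ->
  linear_sum P c h k * `|c * (h * k)%:R - z%:~R| <= 1.
Proof. exact: geom_sum_dist. Qed.

End CubicSums.

(** * Recurrence of multiples near integers *)

Section Recurrence.
Local Open Scope ring_scope.

Lemma shift_absz_inj (x y : int) (k : nat) :
  (absz x <= k)%N -> (absz y <= k)%N -> absz (x + k%:Z)%R = absz (y + k%:Z)%R -> x = y.
Proof. lia. Qed.

Lemma shift_absz_lt (x : int) (k : nat) : (absz x <= k)%N -> (absz (x + k%:Z)%R < (2 * k).+1)%N.
Proof. lia. Qed.

Lemma int_norm_lt1 (x : int) : `|x| < 1 -> x = 0.
Proof. lia. Qed.

Lemma residue_eq (h1 h2 a z1 z2 q : int) :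
  h1 * a - z1 * q = h2 * a - z2 * q -> (h1 - h2) * a = (z1 - z2) * q.
Proof. by move=> E; rewrite !mulrBl; lia. Qed.

Lemma succ_div_mul_le (P q : nat) : (q <= P)%N -> ((P %/ q).+1 * q <= 2 * P)%N.
Proof. by have := leq_divM P q; lia. Qed.

Variable R : realType.
Implicit Types (c eps eta delta : R).

Definition near_int (x eps : R) := exists z : int, `|x - z%:~R| <= eps.

(** Pigeonhole on the fractional parts of [0, c, ..., Y c]. *)
Lemma dirichlet_weak c (Y : nat) : (0 < Y)%N ->
  exists (q : nat) (a : int), (0 < q <= Y)%N /\ `|c * q%:R - a%:~R| <= Y%:R^-1.
Proof.
move=> Y0; have Yp : 0 < Y%:R :> R by rewrite ltr0n.
pose fr (n : nat) : R := c * n%:R - (Num.floor (c * n%:R))%:~R.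
have fr_itv n : 0 <= fr n < 1.
  have /andP [h1 h2] := Num.Theory.floor_itv (c * n%:R).
  by rewrite /fr subr_ge0 h1 ltrBlDl; rewrite intrD in h2.
have cellP n : (Num.truncn (Y%:R * fr n) < Y)%N.
  have /andP [f0 f1] := fr_itv n.
  have /andP [h1 _] := Num.Theory.truncn_itv (mulr_ge0 (ltW Yp) f0).
  rewrite -(ltr_nat R); apply: le_lt_trans h1 _.
  by rewrite -[ltRHS]mulr1 ltr_pM2l.
pose cell (n : 'I_Y.+1) : 'I_Y := Ordinal (cellP n).
have /injectivePn [m [n mn /(congr1 val) /= E]] : ~~ injectiveb cell.
  by apply/injectiveP => /leq_card; rewrite !card_ord ltnn.
wlog lt : m n mn E / (m < n)%N.
  move=> H; case: (ltngtP m n) => [/H|/H|/val_inj /eqP]; last by rewrite (negPf mn).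
  - exact.
  - by apply; rewrite // eq_sym.
exists (n - m)%N, (Num.floor (c * n%:R) - Num.floor (c * m%:R)); split.
  by have := ltn_ord n; lia.
rewrite natrB ?(ltnW lt) // intrB.
have -> : c * (n%:R - m%:R) - ((Num.floor (c * n%:R))%:~R - (Num.floor (c * m%:R))%:~R) = fr n - fr m.
  by rewrite /fr; ring.
have /andP [n0 _] := fr_itv n; have /andP [m0 _] := fr_itv m.
have := Num.Theory.truncn_itv (mulr_ge0 (ltW Yp) n0).
have := Num.Theory.truncn_itv (mulr_ge0 (ltW Yp) m0).
rewrite E -[(Num.Def.trunc _).+1]addn1 natrD => /andP [h1 h2] /andP [h3 h4].
rewrite -(ler_pM2l Yp) mulfV ?gt_eqF //.
have -> : Y%:R * `|fr n - fr m| = `|Y%:R * (fr n - fr m)| by rewrite normrM gtr0_norm.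
rewrite ler_norml.
by apply/andP; split; lra.
Qed.

Lemma dirichlet c (Y : nat) : (0 < Y)%N ->
  exists (q : nat) (a : int), [/\ (0 < q <= Y)%N, coprime q `|a|%N &
    `|c * q%:R - a%:~R| <= Y%:R^-1].
Proof.
move=> /(dirichlet_weak c) [q [a [/andP [q0 qY] h]]].
pose g := gcdn q `|a|%N.
have g0 : (0 < g)%N by rewrite gcdn_gt0 q0.
have /dvdnP [q' eq'] : (g %| q)%N by exact: dvdn_gcdl.
have /dvdzP [a' ea'] : (Posz g %| a)%Z by rewrite dvdzE dvdn_gcdr.
have q'0 : (0 < q')%N by case: (posnP q') eq' q0 => // -> ->; rewrite mul0n.
exists q', a'; split.
- by rewrite q'0; apply: leq_trans qY; rewrite eq' leq_pmulr.
- rewrite /coprime -(eqn_pmul2r g0) mul1n muln_gcdl -eq'.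
  by rewrite -[X in (_ * X)%N](absz_nat g) -abszM -ea'.
- apply: le_trans h; rewrite eq' ea' natrM intrM mulrA -mulrBl normrM normr_nat.
  by rewrite ler_peMr // ler1n.
Qed.

(** Approximate [c] by a reduced fraction [a / q] with error [1 / (4 P q)]. An
    admissible [h] leaves a small residue [h a] modulo [q], so a block of [q]
    consecutive integers holds few of them; as there are many, [q] must be
    small. Then the residue vanishes, hence [q] divides every admissible [h],
    and the largest of them, being at least [q eta P], gives the approximation
    to [c]. *)
Lemma recurrence c eps eta (P : nat) (p : pred nat) :
  0 < eta -> 0 <= eps -> 16 * eps <= eta -> 8 <= eta * P%:R ->
  eta * P%:R <= (size [seq h <- rng P | p h])%:R ->
  (forall h, p h -> near_int (c * h%:R) eps) ->
  exists q : nat, [/\ (0 < q)%N, q%:R * eta <= 1 &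
    near_int (c * q%:R) (eps / (eta * P%:R))].
Proof.
move=> eta0 eps0 h16 h8 hsz hp.
have P0 : (0 < P)%N by rewrite lt0n; apply: contraTneq h8 => ->; rewrite mulr0; lra.
have Pp : 0 < P%:R :> R by rewrite ltr0n.
have [|q [a [/andP [q0 qY] cop hq]]] := @dirichlet c (4 * P); first by lia.
have {}hq : `|c * q%:R - a%:~R| * (4 * P%:R) <= 1.
  by rewrite -ler_pdivlMr ?mulr_gt0 // div1r -natrM.
have qp : 0 < q%:R :> R by rewrite ltr0n.
have cz : coprimez q%:Z a by rewrite coprimezE.
have /choice [z hz] : forall h, exists z : int, p h -> `|c * h%:R - z%:~R| <= eps.
  by move=> h; case: (boolP (p h)) => [/hp [z ?]|_]; [exists z | exists 0].
set H := [seq h <- rng P | p h] in hsz.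
have HP h : h \in H -> [/\ p h, (0 < h)%N & (h <= P)%N].
  by rewrite mem_filter mem_rng => /and3P [].
have uH : uniq H by rewrite filter_uniq // iota_uniq.
pose r (h : nat) : int := h%:Z * a - z h * q%:Z.
have hr h : h \in H -> `|(r h)%:~R| <= eps * q%:R + 1 / 4 :> R.
  move=> /HP [ph h0 hP]; have := hz h ph => e1.
  have -> : (r h)%:~R = (c * h%:R - (z h)%:~R) * q%:R - (c * q%:R - a%:~R) * h%:R :> R.
    by rewrite /r intrB !intrM /=; ring.
  apply: le_trans (ler_normB _ _) _; rewrite !normrM !normr_nat.
  apply: lerD; first by rewrite ler_wpM2r.
  have hP' : h%:R <= P%:R :> R by rewrite ler_nat.
  have := ler_wpM2l (normr_ge0 (c * q%:R - a%:~R)) hP'; lra.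
(* The residues [r h] determine [h] inside a block of length [q], which
   bounds the number of admissible [h] and so forces [q] to be small. *)
have qsmall : q%:R * eta <= 4.
  have y0 : 0 <= eps * q%:R + 1 / 4 by rewrite addr_ge0 // mulr_ge0 // ltW.
  pose K := Num.truncn (eps * q%:R + 1 / 4).
  have /andP [hK _] := Num.Theory.truncn_itv y0; rewrite -/K in hK.
  have rK h : h \in H -> (`|r h| <= K)%N.
    move=> /hr; rewrite -intr_norm -abszE => le.
    rewrite -ltnS -(ltr_nat R); apply: le_lt_trans le _.
    by have /andP [] := Num.Theory.truncn_itv y0.
  pose g h := ((h %/ q)%N, absz (r h + K%:Z)%R).
  have sz : (size H <= (P %/ q).+1 * (2 * K).+1)%N.
    rewrite -(size_map g) -{1}(size_iota 0 (P %/ q).+1) -(size_iota 0 (2 * K).+1).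
    rewrite -(size_allpairs pair); apply: uniq_leq_size.
      rewrite map_inj_in_uniq // => h1 h2 i1 i2 [E1 E2].
      have := rK _ i1; have := rK _ i2 => k2 k1.
      have Er : r h1 = r h2 by exact: shift_absz_inj k1 k2 E2.
      have dv : (q%:Z %| (h1%:Z - h2%:Z) * a)%Z.
        by apply/dvdzP; exists (z h1 - z h2); exact: residue_eq Er.
      rewrite (Gauss_dvdzl _ cz) in dv.
      have /eqP : (h1 == h2 %[mod q])%N.
        by rewrite -eqz_mod_dvd in dv; move: dv; rewrite !modz_nat eqz_nat.
      by move=> E3; rewrite (divn_eq h1 q) (divn_eq h2 q) E1 E3.
    move=> x /mapP [h hH ->]; apply/allpairsP; exists (g h); split.
    - by rewrite mem_iota add0n ltnS; have [_ _ hP] := HP h hH; apply: leq_div2r.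
    - rewrite mem_iota add0n; exact/shift_absz_lt/rK.
    - by [].
  have {}sz : (size H)%:R <= (P %/ q).+1%:R * (2 * (eps * q%:R + 1 / 4) + 1) :> R.
    apply: le_trans (_ : ((P %/ q).+1 * (2 * K).+1)%:R <= _); first by rewrite ler_nat.
    rewrite natrM ler_wpM2l // -addn1 natrD natrM; lra.
  have := le_trans hsz sz; case: (leqP q P) => qP hle.
    have dP : (P %/ q).+1%:R * q%:R <= 2 * P%:R :> R.
      by rewrite -!natrM ler_nat succ_div_mul_le.
    have c0 : 0 <= 2 * (eps * q%:R + 1 / 4) + 1 by lra.
    have := ler_wpM2r c0 dP; have := ler_wpM2r (ltW qp) hle.
    have : eps * q%:R * P%:R * 16 <= eta * q%:R * P%:R.
      by rewrite -!(mulrAC _ P%:R) -mulrA [_ * 16]mulrC !mulrA ler_wpM2r // ?ler_wpM2r //; lra.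
    move=> e1 e2 e3.
    have : (q%:R * eta) * P%:R <= 4 * P%:R by lra.
    by rewrite ler_pM2r.
  move: hle; rewrite divn_small // mul1r => hle.
  have q4 : q%:R <= 4 * P%:R :> R by rewrite -natrM ler_nat.
  have : eps * q%:R <= eta / 16 * (4 * P%:R) by apply: ler_pM => //; lra.
  lra.
have r0 h : h \in H -> r h = 0.
  move=> /hr; have : eps * q%:R <= 1 / 4.
    by have := ler_wpM2r (ltW qp) h16; lra.
  move=> e1 e2; have : `|(r h)%:~R| < 1 :> R by lra.
  by rewrite -intr_norm -[1]/(1%:~R) ltr_int => /int_norm_lt1.
have qh h : h \in H -> (q %| h)%N.
  move=> /r0 E; have : (q%:Z %| h%:Z * a)%Z.
    by apply/dvdzP; exists (z h); exact: subr0_eq E.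
  by rewrite (Gauss_dvdzl _ cz).
have [m hm mx] : exists2 m, (m * q \in H)%N & (size H <= m)%N.
  have Hn : H != [::] by apply: contraTneq hsz => ->; rewrite /= -ltNge; lra.
  have [h0 h0H] : exists h, h \in H by case: (H) Hn => // b l _; exists b; exact: mem_head.
  have [M MH Mmax] := max_mem h0H.
  exists (M %/ q)%N; first by rewrite divnK // qh.
  rewrite -(size_iota 1 (M %/ q)) -(size_map (divn^~ q)); apply: uniq_leq_size.
    rewrite map_inj_in_uniq // => h1 h2 /qh d1 /qh d2 E.
    by rewrite -(divnK d1) -(divnK d2) E.
  move=> x /mapP [h hH ->]; rewrite mem_iota add1n ltnS.
  have [_ h1 _] := HP h hH; rewrite divn_gt0 // (dvdn_leq h1 (qh _ hH)) /=.
  exact/leq_div2r/Mmax.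
have mge : eta * P%:R <= m%:R by apply: le_trans hsz _; rewrite ler_nat.
have mp : 0 < m%:R :> R by lra.
have [pmq _ mqP] := HP _ hm.
exists q; split => //.
  have : m%:R * q%:R <= P%:R :> R by rewrite -natrM ler_nat.
  have := ler_wpM2r (ltW qp) mge => e1 e2.
  have : (q%:R * eta) * P%:R <= 1 * P%:R by lra.
  by rewrite ler_pM2r.
exists a.
have := hz _ pmq; have := r0 _ hm; rewrite /r => E.
have -> : z (m * q)%N = m%:Z * a.
  apply: (@mulIf _ q%:Z); first by rewrite eqz_nat -lt0n.
  by rewrite -(subr0_eq E) PoszM mulrAC.
rewrite intrM natrM -pmulrn => hmm.
have : `|c * q%:R - a%:~R| * m%:R <= eps.
  rewrite -[m%:R]normr_nat -normrM; apply: le_trans hmm; rewrite le_eqVlt; apply/orP; left.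
  by apply/eqP; congr (`| _ |); ring.
rewrite ler_pdivlMr; last by lra.
by apply: le_trans; rewrite ler_wpM2l.
Qed.

End Recurrence.

(** * Rational approximation from a large bilinear sum *)

Section Approximation.
Local Open Scope ring_scope.
Variable R : realType.
Implicit Types (c t delta : R).

Lemma count_large (F : nat -> R) (M t : R) (s : seq nat) :
  0 <= t -> (forall h, h \in s -> F h <= M) ->
  \sum_(h <- s) F h <= M * (size [seq h <- s | t <= F h])%:R + t * (size s)%:R.
Proof.
move=> t0 FM; rewrite size_filter_sum mulr_sumr -sum1_size natr_sum mulr_sumr -big_split /=.
rewrite big_seq [leRHS]big_seq; apply: ler_sum => h hs; rewrite mulr1.
case: (leP t (F h)) => [_|/ltW]; last by rewrite mulr0 add0r.
by rewrite mulr1 -[leLHS]addr0 lerD // FM.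
Qed.

Lemma pigeonhole (s : seq nat) (f : nat -> nat) (n : nat) :
  (forall h, h \in s -> (0 < f h <= n)%N) -> s != [::] ->
  exists2 q, (0 < q <= n)%N & (size s <= n * size [seq h <- s | f h == q])%N.
Proof.
move=> fs sn.
have [x xs] : exists x, x \in s by case: (s) sn => // b l _; exists b; exact: mem_head.
have [m /mapP [q qn ->] mx] : exists2 m,
    m \in [seq size [seq h <- s | f h == q] | q <- rng n] &
    forall y, y \in [seq size [seq h <- s | f h == q] | q <- rng n] -> (y <= m)%N.
  by apply: (@max_mem _ (size [seq h <- s | f h == f x])); apply: (map_f (fun q => size [seq h <- s | f h == q])); rewrite mem_rng fs.
exists q; first by rewrite -mem_rng.
have -> : size s = (\sum_(q <- rng n) size [seq h <- s | f h == q])%N.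
  rewrite (eq_bigr (fun q => \sum_(h <- s) (f h == q)))%N; last first.
    by move=> i _; rewrite size_filter -sum1_count big_mkcond; apply: eq_bigr => h _; case: (_ == _).
  rewrite exchange_big /= -sum1_size; apply: eq_big_seq => h hs.
  rewrite (bigD1_seq (f h)) ?mem_rng ?fs ?iota_uniq //= eqxx big1 ?addn0 //.
  by move=> i /negPf; rewrite eq_sym => ->.
apply: (@leq_trans (\sum_(i <- rng n) size [seq h <- s | f h == q])%N).
  rewrite big_seq [leqRHS]big_seq; apply: leq_sum => i ni; apply: mx.
  exact: (map_f (fun q => size [seq h <- s | f h == q])).
by rewrite sum_nat_const_nat subn1.
Qed.

(** For many [h] the sum over [k] is large, hence [c h k] is close to an
    integer for many [k], and [recurrence] gives a small [q] with [c h q] very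
    close to an integer. Some [q] serves many [h], so [recurrence] applies a
    second time, to [c q] and the variable [h]. *)
Lemma rational_approx c delta (P : nat) :
  0 < delta -> delta <= 1 -> 256 <= delta ^+ 2 * P%:R ->
  delta * P%:R ^+ 3 <= \sum_(h <- rng P) \sum_(k <- rng P) linear_sum P c h k ->
  exists (q : nat) (a : int), [/\ (0 < q)%N, q%:R * delta ^+ 3 <= 32 &
    `|c * q%:R - a%:~R| * (delta ^+ 4 * P%:R ^+ 3) <= 128].
Proof.
move=> d0 d1 dP hS.
have P0 : (0 < P)%N by rewrite lt0n; apply: contraTneq dP => ->; rewrite mulr0; lra.
have Pp : 0 < P%:R :> R by rewrite ltr0n.
have dP1 : 256 <= delta * P%:R.
  apply: le_trans dP _; apply: ler_wpM2r; first exact: ltW.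
  by rewrite expr2 ler_piMr // ltW.
have dPp : 0 < delta * P%:R by rewrite mulr_gt0.
have szr : size (rng P) = P by rewrite size_iota subn1.
pose T h := \sum_(k <- rng P) linear_sum P c h k.
have TP h : T h <= P%:R ^+ 2.
  apply: (@le_trans _ _ (\sum_(k <- rng P) P%:R)); first by apply: ler_sum => k _; exact: linear_sum_le.
  by rewrite sum_cst subn1 expr2.
have t0 : 0 <= delta * P%:R ^+ 2 / 2 by rewrite divr_ge0 ?mulr_ge0 ?exprn_ge0 ?ltW.
have := @count_large T (P%:R ^+ 2) _ (rng P) t0 (fun h _ => TP h).
rewrite szr; set H1 := [seq h <- rng P | _] => cH1.
have sH1 : delta * P%:R / 2 <= (size H1)%:R.
  rewrite -(ler_pM2l (exprn_gt0 2 Pp)).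
  have := le_trans hS cH1; lra.
have rec1 h : exists q : nat, h \in H1 -> [/\ (0 < q)%N, q%:R * (delta / 4) <= 1 &
    near_int (c * h%:R * q%:R) (16 / (delta ^+ 2 * P%:R ^+ 2))].
  case: (boolP (h \in H1)) => [|_]; last by exists 0%N.
  rewrite mem_filter => /andP [hT _].
  have t1 : 0 <= delta * P%:R / 4 by rewrite divr_ge0 // ltW.
  have := @count_large (linear_sum P c h) P%:R _ (rng P) t1 (fun k _ => linear_sum_le P c h k).
  pose p k := delta * P%:R / 4 <= linear_sum P c h k.
  rewrite szr -[[seq _ <- _ | _]]/[seq k <- rng P | p k] => ck.
  have sK : delta / 4 * P%:R <= (size [seq k <- rng P | p k])%:R.
    rewrite -(ler_pM2l Pp); have := le_trans hT ck; lra.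
  have [|||||k pk|q [q0 q1 q2]] := @recurrence R (c * h%:R) (4 / (delta * P%:R)) (delta / 4) P p.
  - by rewrite divr_gt0.
  - by rewrite divr_ge0 // ltW.
  - rewrite mulrA ler_pdivrMr // -(ler_pM2l (_ : 0 < 4)) //; lra.
  - lra.
  - exact: sK.
  - have [z hz] := nearest (c * h%:R * k%:R); exists z.
    rewrite ler_pdivlMr //.
    have hz' : `|c * (h * k)%:R - z%:~R| <= 1 / 2 by rewrite natrM mulrA.
    have := linear_sum_dist P hz'; rewrite natrM mulrA.
    have := ler_wpM2r (normr_ge0 (c * h%:R * k%:R - z%:~R))
      (pk : delta * P%:R / 4 <= linear_sum P c h k); lra.
  exists q => _; split => //.
  have -> // : 16 / (delta ^+ 2 * P%:R ^+ 2) = 4 / (delta * P%:R) / (delta / 4 * P%:R).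
  by field; rewrite !gt_eqF.
have /choice [q hq] := rec1.
pose n := Num.truncn (4 / delta).
have y0 : 0 <= 4 / delta by rewrite divr_ge0 // ltW.
have /andP [n1 n2] := Num.Theory.truncn_itv y0; rewrite -/n in n1 n2.
have H1n : H1 != [::] by apply: contraTneq sH1 => ->; rewrite /= -ltNge; lra.
have [h /hq [h1 h2 _]|q1 /andP [q10 q1n] hsz] := @pigeonhole H1 q n _ H1n.
  rewrite h1 -ltnS -(ltr_nat R); apply: le_lt_trans n2.
  by rewrite ler_pdivlMr //; lra.
set H2 := [seq h <- H1 | q h == q1] in hsz.
have q1d : q1%:R * delta <= 4.
  have : q1%:R <= n%:R :> R by rewrite ler_nat.
  by move=> le; rewrite -ler_pdivlMr //; exact: le_trans n1.
have sH2 : delta ^+ 2 / 8 * P%:R <= (size H2)%:R.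
  have : delta * P%:R / 2 <= n%:R * (size H2)%:R.
    by apply: le_trans sH1 _; rewrite -natrM ler_nat.
  have : n%:R * (size H2)%:R <= 4 / delta * (size H2)%:R by rewrite ler_wpM2r.
  move=> e1 e2; have := ler_wpM2l (ltW d0) (le_trans e2 e1).
  have -> : delta * (4 / delta * (size H2)%:R) = 4 * (size H2)%:R by field; rewrite gt_eqF.
  lra.
have e0 : 0 < delta ^+ 2 * P%:R ^+ 2 by rewrite mulr_gt0 ?exprn_gt0.
have [|||||h|q2 [q20 q21 q22]] := @recurrence R (c * q1%:R) (16 / (delta ^+ 2 * P%:R ^+ 2))
    (delta ^+ 2 / 8) P (fun h => (h \in H2)).
- by rewrite divr_gt0 ?exprn_gt0.
- by rewrite divr_ge0 // ltW.
- rewrite mulrA ler_pdivrMr //.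
  have : 256 * 256 <= (delta ^+ 2 * P%:R) * (delta ^+ 2 * P%:R).
    exact: (ler_pM (ler0n _ _) (ler0n _ _) dP dP).
  lra.
- lra.
- apply: le_trans sH2 _; rewrite ler_nat; apply: uniq_leq_size.
    by rewrite !filter_uniq // iota_uniq.
  by move=> h hH; rewrite mem_filter hH; move: hH; rewrite !mem_filter => /andP [_ /andP [_ ->]].
- by rewrite mem_filter => /andP [/eqP <- /hq [_ _]]; rewrite mulrAC.
case: q22 => a ha; exists (q1 * q2)%N, a; split; first by rewrite muln_gt0 q10.
  rewrite natrM.
  have d3 : 0 <= q2%:R * (delta ^+ 2 / 8) by rewrite mulr_ge0 // divr_ge0 // exprn_ge0 // ltW.
  have := ler_wpM2r d3 q1d; lra.
rewrite natrM mulrA -ler_pdivlMr ?mulr_gt0 ?exprn_gt0 //.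
apply: le_trans ha _; rewrite le_eqVlt; apply/orP; left; apply/eqP.
by field; rewrite !gt_eqF.
Qed.

Lemma offdiag_le_rng P (b : R) : Normc.normc (offdiag P b) <= \sum_(h <- rng P) \sum_(k <- rng P) linear_sum P (6 * b) h k.
Proof.
apply: le_trans (offdiag_le P b) _.
case: P => [|P]; first by rewrite big_geq // big_nil.
rewrite [leRHS]big_nat_recr //=; apply: ler_wpDr.
  by apply: sumr_ge0 => k _; exact: linear_sum_ge0.
apply: ler_sum => h _; rewrite [leRHS]big_nat_recr //=; apply: ler_wpDr => //.
exact: linear_sum_ge0.
Qed.

End Approximation.

(** * Divisor sums and major arcs *)

Section Divisors.
Local Open Scope ring_scope.
Variable R : realType.

Lemma sum_multiples (F : nat -> R) d n : (0 < d)%N ->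
  \sum_(h <- rng n) (d %| h)%:R * F h = \sum_(h <- rng (n %/ d)) F (d * h)%N.
Proof.
move=> d0.
rewrite (eq_bigr (fun h => if (d %| h)%N then F h else 0)); last first.
  by move=> h _; case: (_ %| _)%N; rewrite ?mul1r ?mul0r.
rewrite -big_mkcond -big_filter -(big_map (muln d) predT F); apply: perm_big.
apply: uniq_perm; first by rewrite filter_uniq ?iota_uniq.
  rewrite map_inj_uniq ?iota_uniq // => x y /eqP; rewrite eqn_pmul2l // => /eqP.
  exact.
move=> x; rewrite mem_filter mem_rng; apply/andP/mapP => [[/dvdnP [y ->] h]|[y + ->]].
  exists y; last exact: mulnC.
  by rewrite mem_rng leq_divRL //; move: h; rewrite muln_gt0 => /andP [/andP [-> _] ->].
rewrite mem_rng leq_divRL // mulnC => /andP [y0 ->]; split; last by rewrite muln_gt0 d0 y0.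
exact: dvdn_mulr.
Qed.

Lemma sum_invsqrt n : \sum_(h <- rng n) (Num.sqrt h%:R)^-1 <= 2 * Num.sqrt n%:R :> R.
Proof.
elim: n => [|n IH]; first by rewrite big_nil sqrtr0 mulr0.
rewrite big_nat_recr //=; apply: le_trans (lerD IH (lexx _)) _.
have s0 : 0 < Num.sqrt n.+1%:R :> R by rewrite sqrtr_gt0 ltr0n.
have t0 : 0 <= Num.sqrt n%:R :> R by exact: sqrtr_ge0.
have se : Num.sqrt n.+1%:R ^+ 2 = Num.sqrt n%:R ^+ 2 + 1 :> R.
  by rewrite !sqr_sqrtr // -addn1 natrD.
have le : Num.sqrt n%:R <= Num.sqrt n.+1%:R :> R by rewrite ler_wsqrtr // ler_nat.
rewrite -(ler_pM2l s0) mulrDr mulfV ?gt_eqF //; nra.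
Qed.

Lemma sum_invsqrt_mult d n : (0 < d)%N ->
  \sum_(h <- rng n) (d %| h)%:R * (Num.sqrt h%:R)^-1 <= 2 * Num.sqrt n%:R / d%:R :> R.
Proof.
move=> d0; rewrite sum_multiples //.
have sd0 : 0 < Num.sqrt d%:R :> R by rewrite sqrtr_gt0 ltr0n.
have dE : d%:R = Num.sqrt d%:R * Num.sqrt d%:R :> R by rewrite -expr2 sqr_sqrtr.
apply: (@le_trans _ _ ((Num.sqrt d%:R)^-1 * (2 * Num.sqrt (n %/ d)%:R))).
  rewrite (eq_bigr (fun h : nat => (Num.sqrt d%:R)^-1 * (Num.sqrt h%:R)^-1)).
    by rewrite -mulr_sumr ler_wpM2l ?invr_ge0 ?sqrtr_ge0 ?sum_invsqrt.
  by move=> h _; rewrite natrM sqrtrM // invfM.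
rewrite mulrC -!mulrA ler_pM2l // [in leRHS]dE invfM mulrA ler_pM2r ?invr_gt0 //.
rewrite ler_pdivlMr // -sqrtrM // ler_wsqrtr // -natrM ler_nat.
exact: leq_divM.
Qed.

Lemma sum_inv_mult d n : (0 < d)%N ->
  \sum_(h <- rng n) (d %| h)%:R * h%:R^-1 <= harm R n / d%:R.
Proof.
move=> d0; rewrite sum_multiples // (eq_bigr (fun h : nat => d%:R^-1 * h%:R^-1)); last first.
  by move=> h _; rewrite natrM invfM.
by rewrite -mulr_sumr mulrC ler_wpM2r ?invr_ge0 //; apply: harm_le; exact: leq_div.
Qed.

Definition tau (q : nat) : R := \sum_(d <- rng q) (d %| q)%:R.

(** Summing over a range that does not depend on [q] allows the sums over [q]
    and over its divisors to be exchanged. *)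
Lemma tau_widen q n : (0 < q)%N -> (q <= n)%N -> tau q = \sum_(d <- rng n) (d %| q)%:R.
Proof.
move=> q0 qn; rewrite /tau [RHS](@big_cat_nat _ _ _ q.+1) //=.
rewrite [X in _ + X]big1_seq ?addr0 // => d; rewrite mem_index_iota => /andP [_ /andP [h _]].
by rewrite gtnNdvd.
Qed.

Lemma tau_ge1 q : (0 < q)%N -> 1 <= tau q.
Proof.
move=> q0; rewrite /tau (bigD1_seq 1%N) ?mem_rng ?iota_uniq //= dvd1n lerDl.
by apply: sumr_ge0.
Qed.

(** Expand the square, sum over the multiples of the lcm, and bound [1 /
    lcm(x, z) = gcd(x, z) / (x z)] by the sum of [g / (x z)] over all common
    divisors [g]. *)
Lemma sum_tau_sqr n : \sum_(q <- rng n) tau q ^+ 2 / q%:R <= harm R n ^+ 4.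
Proof.
have H0 := @harm_ge0 R n; set H := harm R n in H0 *.
apply: (@le_trans _ _ (\sum_(x <- rng n) \sum_(z <- rng n) H / (lcmn x z)%:R)).
  rewrite (eq_big_seq (fun q => \sum_(x <- rng n) \sum_(z <- rng n)
      (lcmn x z %| q)%:R * q%:R^-1)); last first.
    move=> q; rewrite mem_rng => /andP [q0 qn]; rewrite (tau_widen q0 qn) expr2 !mulr_suml.
    apply: eq_bigr => x _; rewrite mulr_sumr mulr_suml; apply: eq_bigr => z _.
    by rewrite -natrM mulnb dvdn_lcm.
  rewrite exchange_big; rewrite big_seq [leRHS]big_seq; apply: ler_sum => x; rewrite mem_rng => /andP [x0 _].
  rewrite exchange_big; rewrite big_seq [leRHS]big_seq; apply: ler_sum => z; rewrite mem_rng => /andP [z0 _].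
  by apply: sum_inv_mult; rewrite lcmn_gt0 x0.
apply: (@le_trans _ _ (\sum_(x <- rng n) \sum_(z <- rng n) \sum_(g <- rng n)
    H * (g%:R * ((g %| x)%:R * x%:R^-1) * ((g %| z)%:R * z%:R^-1)))).
  rewrite big_seq [leRHS]big_seq; apply: ler_sum => x; rewrite mem_rng => /andP [x0 xn].
  rewrite big_seq [leRHS]big_seq; apply: ler_sum => z; rewrite mem_rng => /andP [z0 zn].
  have g0 : (0 < gcdn x z)%N by rewrite gcdn_gt0 x0.
  have gn : (gcdn x z <= n)%N by apply: leq_trans xn; rewrite dvdn_leq // dvdn_gcdl.
  rewrite (bigD1_seq (gcdn x z)) ?mem_rng ?g0 ?iota_uniq //= dvdn_gcdl dvdn_gcdr !mul1r.
  rewrite ler_wpDr //; last first.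
    have -> // : (lcmn x z)%:R^-1 = (gcdn x z)%:R / x%:R / z%:R :> R.
    have : ((lcmn x z)%:R * (gcdn x z)%:R = x%:R * z%:R :> R) by rewrite -!natrM muln_lcm_gcd.
    have [? ? ? ?] : [/\ x%:R != 0 :> R, z%:R != 0 :> R, (gcdn x z)%:R != 0 :> R & (lcmn x z)%:R != 0 :> R].
      by rewrite !pnatr_eq0 -!lt0n lcmn_gt0 x0 z0 g0.
    move=> E; apply: (@mulfI _ (lcmn x z)%:R) => //; rewrite mulfV // !mulrA E; field.
    by apply/andP.
  by apply: sumr_ge0 => g _; rewrite !mulr_ge0 ?invr_ge0.
under eq_bigr do rewrite exchange_big.
rewrite exchange_big /=.
apply: (@le_trans _ _ (\sum_(g <- rng n) H * (g%:R * (H / g%:R) * (H / g%:R)))).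
  rewrite big_seq [leRHS]big_seq; apply: ler_sum => g; rewrite mem_rng => /andP [g0 _].
  apply: (@le_trans _ _ (H * (g%:R * (\sum_(x <- rng n) (g %| x)%:R * x%:R^-1) *
     (\sum_(z <- rng n) (g %| z)%:R * z%:R^-1)))).
    rewrite -mulrA mulr_suml !mulr_sumr; apply: ler_sum => x _.
    by rewrite !mulr_sumr; apply: ler_sum => z _; rewrite -!mulrA.
  have s0 : 0 <= \sum_(x <- rng n) (g %| x)%:R * x%:R^-1 :> R.
    by apply: sumr_ge0 => x _; rewrite mulr_ge0 ?invr_ge0.
  rewrite ler_wpM2l // ler_pM ?mulr_ge0 //; last exact: sum_inv_mult.
  by rewrite ler_wpM2l //; exact: sum_inv_mult.
have -> : H ^+ 4 = H ^+ 3 * harm R n by rewrite exprSr.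
rewrite /harm mulr_sumr big_seq [leRHS]big_seq; apply: ler_sum => g; rewrite mem_rng => /andP [g0 _].
rewrite le_eqVlt; apply/orP; left; apply/eqP; field; rewrite pnatr_eq0; lia.
Qed.

(** The divisor [d = gcd(q, h)] is counted on the right. *)
Lemma dvd_mul_le (q h k : nat) : (0 < q)%N ->
  ((q %| h * k)%:R <= \sum_(d <- rng q) (d %| q)%:R * ((d %| h)%:R * ((q %/ d) %| k)%:R) :> R).
Proof.
move=> q0; case: (boolP (q %| h * k)%N) => [qhk|_]; last by apply: sumr_ge0.
have g0 : (0 < gcdn q h)%N by rewrite gcdn_gt0 q0.
rewrite (bigD1_seq (gcdn q h)) ?iota_uniq ?mem_rng ?g0 //=; last by rewrite dvdn_leq // dvdn_gcdl.
rewrite dvdn_gcdl dvdn_gcdr !mul1r.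
suff -> : (q %/ gcdn q h %| k)%N by rewrite lerDl; apply: sumr_ge0.
rewrite -(@Gauss_dvdr _ (h %/ gcdn q h)).
  rewrite -(@dvdn_pmul2r (gcdn q h)) // divnK ?dvdn_gcdl //.
  by rewrite mulnAC divnK // dvdn_gcdr.
by rewrite /coprime -(eqn_pmul2r g0) mul1n muln_gcdl !divnK ?dvdn_gcdl ?dvdn_gcdr.
Qed.

End Divisors.

Section MajorArc.
Local Open Scope ring_scope.
Variable R : realType.

(** If [q] does not divide [h k], the frequency [c h k] is at distance at
    least [1 / (2 q)] from the integers. Otherwise this distance is [h k T /
    P^3]; the resulting bound is combined with the trivial one in the
    symmetric form [2 P^2 / sqrt((1 + T) h k)], which can be summed over [h]
    and [k] separately for each divisor of [q]. *)
Lemma major_arc (c : R) (P q : nat) (a : int) :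
  (0 < q)%N -> coprime q `|a|%N ->
  let T := P%:R ^+ 3 * `|c - a%:~R / q%:R| in
  2 * q%:R ^+ 2 * (1 + T) <= P%:R ->
  (\sum_(h <- rng P) \sum_(k <- rng P) linear_sum P c h k) ^+ 2 <=
    81 * P%:R ^+ 6 * (tau R q ^+ 2 / (q%:R ^+ 2 * (1 + T))).
Proof.
move=> q0 cop T hP.
have qp : 0 < q%:R :> R by rewrite ltr0n.
have q1 : 1 <= q%:R :> R by rewrite ler1n.
set th := c - a%:~R / q%:R in T hP *.
have T0 : 0 <= T by rewrite mulr_ge0 ?exprn_ge0.
have qq : 1 <= q%:R ^+ 2 :> R by rewrite expr_ge1.
have Pp : 0 < P%:R :> R by apply: lt_le_trans hP; rewrite mulr_gt0 //; lra.
have cE : c = a%:~R / q%:R + th by rewrite addrC subrK.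
have hkth h k : h \in rng P -> k \in rng P -> (h * k)%:R * `|th| * P%:R <= T.
  rewrite !mem_rng => /andP [_ hh] /andP [_ kk].
  have : (h * k)%:R <= P%:R * P%:R :> R by rewrite -natrM ler_nat leq_mul.
  have p0 : 0 <= `|th| * P%:R by rewrite mulr_ge0.
  move/(ler_wpM2r p0); rewrite /T; lra.
pose w : R := 2 * P%:R ^+ 2 / Num.sqrt (1 + T).
have w0 : 0 <= w by rewrite divr_ge0 ?sqrtr_ge0 // mulr_ge0 // exprn_ge0.
have bound h k : h \in rng P -> k \in rng P -> linear_sum P c h k <= 2 * q%:R +
    (q %| h * k)%:R * (w * (Num.sqrt h%:R)^-1 * (Num.sqrt k%:R)^-1).
  move=> hh kk; have hk := hkth _ _ hh kk.
  have /andP [h0 hleP] : (0 < h <= P)%N by rewrite -mem_rng.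
  have /andP [k0 kleP] : (0 < k <= P)%N by rewrite -mem_rng.
  have nth : `|th * (h * k)%:R| * P%:R <= T by rewrite normrM normr_nat [_ * (h * k)%:R]mulrC.
  have L0 := linear_sum_ge0 P c h k; have LP := linear_sum_le P c h k.
  have E : c * (h * k)%:R = (a * (h * k)%:Z)%:~R / q%:R + th * (h * k)%:R.
    by rewrite intrM -pmulrn {1}cE; field; rewrite gt_eqF.
  case: (boolP (q %| h * k)%N) => [/dvdnP [m hkE]|nd]; last first.
    rewrite mul0r addr0.
    have [z hz] := nearest (c * (h * k)%:R).
    have l1 := linear_sum_dist P hz.
    have : 1 <= `|(a * (h * k)%:Z)%:~R - z%:~R * q%:R| :> R.
      rewrite -[q%:R]/(q%:Z%:~R) -intrM -intrB -intr_norm -[1]/(1%:~R) ler_int.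
      rewrite -gtz0_ge1 normr_gt0 subr_eq0; apply: contra nd => /eqP ez.
      have : (q%:Z %| a * (h * k)%:Z)%Z by apply/dvdzP; exists z.
      by rewrite Gauss_dvdzr // coprimezE.
    have -> : (a * (h * k)%:Z)%:~R - z%:~R * q%:R =
       ((c * (h * k)%:R - z%:~R) - th * (h * k)%:R) * q%:R :> R.
      by rewrite E; field; rewrite gt_eqF.
    rewrite normrM normr_nat => e1.
    have e2 := ler_normB (c * (h * k)%:R - z%:~R) (th * (h * k)%:R).
    set D := `|c * _ - _| in l1 e2 *; set D' := `|th * _| in nth e2.
    have e3 : 2 * (D' * q%:R) <= 1.
      rewrite -(ler_pM2r Pp) mul1r.
      have := ler_wpM2l (ltW qp) nth.
      have : q%:R * T <= q%:R ^+ 2 * (1 + T) by rewrite expr2 -mulrA ler_wpM2l // ; nra.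
      lra.
    have e4 : 1 <= 2 * (D * q%:R).
      have := ler_wpM2r (ltW qp) e2; lra.
    have := ler_wpM2l L0 e4; have := ler_wpM2r (ltW qp) l1; lra.
  rewrite mul1r; apply: ler_wpDl; first by rewrite mulr_ge0.
  have l1 : linear_sum P c h k * `|th * (h * k)%:R| <= 1.
    have E' : c * (h * k)%:R - (a * m%:Z)%:~R = th * (h * k)%:R.
      rewrite E hkE PoszM !intrM -!pmulrn; field; rewrite gt_eqF //.
    have e3 : `|th * (h * k)%:R| <= 1 / 2.
      rewrite -(ler_pM2r Pp); apply: (le_trans nth).
      have : 2 * (1 + T) <= 2 * q%:R ^+ 2 * (1 + T) by rewrite ler_wpM2r //; lra.
      lra.
    by rewrite -E'; apply: linear_sum_dist; rewrite E'.
  rewrite normrM normr_nat in l1.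
  have hp : 0 < (h * k)%:R :> R by rewrite ltr0n muln_gt0 h0.
  have hP2 : (h * k)%:R <= P%:R ^+ 2 :> R.
    by rewrite -natrX ler_nat expnS expn1 leq_mul.
  have key : linear_sum P c h k ^+ 2 * ((1 + T) * (h * k)%:R) <= (2 * P%:R ^+ 2) ^+ 2.
    have e1 : linear_sum P c h k ^+ 2 * (h * k)%:R <= P%:R ^+ 2 * P%:R ^+ 2.
      by rewrite ler_pM ?exprn_ge0 // lerXn2r ?nnegrE.
    have e2 : linear_sum P c h k ^+ 2 * (T * (h * k)%:R) <= P%:R ^+ 4.
      have -> : linear_sum P c h k ^+ 2 * (T * (h * k)%:R) =
         linear_sum P c h k * (linear_sum P c h k * (`|th| * (h * k)%:R)) * P%:R ^+ 3 by rewrite /T; ring.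
      rewrite [P%:R ^+ 4]exprS ler_wpM2r ?exprn_ge0 //.
      by rewrite -[leRHS]mulr1 ler_pM // mulr_ge0 // mulr_ge0.
    have e3 : 0 <= P%:R ^+ 4 :> R by rewrite exprn_ge0.
    lra.
  have T1 : 0 < Num.sqrt (1 + T) by rewrite sqrtr_gt0; lra.
  have sh : 0 < Num.sqrt h%:R :> R by rewrite sqrtr_gt0 ltr0n.
  have sk : 0 < Num.sqrt k%:R :> R by rewrite sqrtr_gt0 ltr0n.
  have -> : w * (Num.sqrt h%:R)^-1 * (Num.sqrt k%:R)^-1 =
      2 * P%:R ^+ 2 / (Num.sqrt (1 + T) * (Num.sqrt h%:R * Num.sqrt k%:R)).
    by rewrite /w; field; rewrite !gt_eqF.
  rewrite ler_pdivlMr ?mulr_gt0 //.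
  rewrite -(@ler_pXn2r _ 2) ?nnegrE ?mulr_ge0 ?sqrtr_ge0 ?exprn_ge0 //.
  rewrite !exprMn !sqr_sqrtr // in key *; last by lra.
  by apply: le_trans key; rewrite natrM.
have sumb : \sum_(h <- rng P) \sum_(k <- rng P) linear_sum P c h k <=
    2 * q%:R * P%:R ^+ 2 + 4 * w * P%:R * tau R q / q%:R.
  apply: (@le_trans _ _ (\sum_(h <- rng P) \sum_(k <- rng P) (2 * q%:R +
     \sum_(d <- rng q) (d %| q)%:R * (w * ((d %| h)%:R * (Num.sqrt h%:R)^-1) *
        (((q %/ d) %| k)%:R * (Num.sqrt k%:R)^-1))))).
    rewrite big_seq [leRHS]big_seq; apply: ler_sum => h hh.
    rewrite big_seq [leRHS]big_seq; apply: ler_sum => k kk.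
    apply: le_trans (bound _ _ hh kk) _; rewrite lerD2l.
    have u0 : 0 <= w * (Num.sqrt h%:R)^-1 * (Num.sqrt k%:R)^-1.
      by rewrite !mulr_ge0 ?invr_ge0 ?sqrtr_ge0.
    apply: le_trans (ler_wpM2r u0 (dvd_mul_le R h k q0)) _.
    rewrite mulr_suml; apply: ler_sum => d _; rewrite le_eqVlt; apply/orP; left; apply/eqP; ring.
  under eq_bigr do rewrite big_split /=.
  rewrite big_split /= lerD //.
    by rewrite !sum_cst !subn1 /=; lra.
  under eq_bigr do rewrite exchange_big /=.
  rewrite exchange_big /= /tau mulr_sumr mulr_suml.
  rewrite big_seq [leRHS]big_seq; apply: ler_sum => d; rewrite mem_rng => /andP [d0 dq].
  case: (boolP (d %| q)%N) => [/dvdnP [m qE]|_]; last first.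
    by rewrite mulr0 mul0r big1 // => h _; rewrite big1 // => k _; rewrite mul0r.
  have m0 : (0 < m)%N by move: q0; rewrite qE muln_gt0 => /andP [].
  rewrite qE mulnK //.
  have := sum_invsqrt_mult R P d0; have := sum_invsqrt_mult R P m0.
  set A := \sum_(h <- rng P) _; set B := \sum_(h <- rng P) _ => hA hB.
  have A0 : 0 <= A by apply: sumr_ge0 => x _; rewrite mulr_ge0 ?invr_ge0 ?sqrtr_ge0.
  have B0 : 0 <= B by apply: sumr_ge0 => x _; rewrite mulr_ge0 ?invr_ge0 ?sqrtr_ge0.
  have := ler_pM B0 A0 hB hA => /(ler_wpM2l w0).
  have -> : w * (2 * Num.sqrt P%:R / d%:R * (2 * Num.sqrt P%:R / m%:R)) =
    4 * w * P%:R * true%:R / (m * d)%:R.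
    have sP : Num.sqrt P%:R * Num.sqrt P%:R = P%:R :> R by rewrite -expr2 sqr_sqrtr.
    rewrite -[in RHS]sP natrM -[true%:R]/(1 : R) mulr1; field.
    by rewrite !pnatr_eq0 -!lt0n m0 d0.
  apply: le_trans; rewrite le_eqVlt; apply/orP; left; apply/eqP.
  rewrite mulrA [w * B]mulr_sumr mulr_suml; apply: eq_bigr => h _.
  by rewrite mulr_sumr; apply: eq_bigr => k _; rewrite mul1r.
have T1 : 0 < Num.sqrt (1 + T) by rewrite sqrtr_gt0; lra.
have sT : Num.sqrt (1 + T) <= 1 + T.
  have : 1 <= Num.sqrt (1 + T) by rewrite -[X in X <= _]sqrtr1 ler_wsqrtr //; lra.
  have : Num.sqrt (1 + T) ^+ 2 = 1 + T by rewrite sqr_sqrtr //; lra.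
  set s := Num.sqrt _; nra.
have t1 := tau_ge1 R q0.
have fin : \sum_(h <- rng P) \sum_(k <- rng P) linear_sum P c h k <=
    9 * P%:R ^+ 3 * (tau R q / (q%:R * Num.sqrt (1 + T))).
  apply: (le_trans sumb).
  have -> : 4 * w * P%:R * tau R q / q%:R = 8 * P%:R ^+ 3 * (tau R q / (q%:R * Num.sqrt (1 + T))).
    by rewrite /w; field; rewrite !gt_eqF.
  suff : 2 * q%:R * P%:R ^+ 2 <= P%:R ^+ 3 * (tau R q / (q%:R * Num.sqrt (1 + T))) by lra.
  rewrite mulrA ler_pdivlMr ?mulr_gt0 //.
  apply: (@le_trans _ _ (P%:R ^+ 3 * 1)); last by rewrite ler_wpM2l ?exprn_ge0.
  have -> : 2 * q%:R * P%:R ^+ 2 * (q%:R * Num.sqrt (1 + T)) =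
     P%:R ^+ 2 * (2 * q%:R ^+ 2 * Num.sqrt (1 + T)) by ring.
  rewrite mulr1 [leRHS]exprSr ler_wpM2l ?exprn_ge0 //; apply: le_trans hP.
  by rewrite ler_wpM2l // mulr_ge0 // exprn_ge0.
have S0 : 0 <= \sum_(h <- rng P) \sum_(k <- rng P) linear_sum P c h k.
  by apply: sumr_ge0 => h _; apply: sumr_ge0 => k _; exact: linear_sum_ge0.
apply: (@le_trans _ _ ((9 * P%:R ^+ 3 * (tau R q / (q%:R * Num.sqrt (1 + T)))) ^+ 2)).
  by rewrite lerXn2r ?nnegrE // (le_trans S0).
have : Num.sqrt (1 + T) ^+ 2 = 1 + T by rewrite sqr_sqrtr //; lra.
set s := Num.sqrt _ in T1 *; move=> <-; rewrite le_eqVlt; apply/orP; left; apply/eqP.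
by field; rewrite !gt_eqF.
Qed.

End MajorArc.

(** * Levels of the off-diagonal sum *)

(** Compare [(n + 1)^k] with [k!] times one binomial coefficient of order [n +
    k]. *)
Lemma expn_le_exp2 k n : (n.+1 ^ k <= k`! * 2 ^ k * 2 ^ n)%N.
Proof.
have h1 : (n.+1 ^ k <= (n + k) ^_ k)%N.
  elim: k => [|k IH]; first by rewrite ffactn0.
  rewrite addnS ffactnS /= expnS leq_mul //; by lia.
apply: leq_trans h1 _; rewrite -bin_ffact mulnC -mulnA leq_mul2l; apply/orP; right.
rewrite -expnD.
have -> : (2 ^ (k + n) = \sum_(i < (n + k).+1) 'C(n + k, i))%N.
  rewrite addnC (Pascal 1 1 (n + k)) ; apply: eq_bigr => i _; by rewrite !exp1n !muln1.
have kn : (k < (n + k).+1)%N by lia.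
by rewrite (bigD1 (Ordinal kn)) //= leq_addr.
Qed.

Lemma poly_le_exp a k : exists l0, forall l, (l0 <= l)%N -> (2 ^ a * (l + 2) ^ k <= 2 ^ l)%N.
Proof.
exists (2 ^ a * ((k.+1)`! * 2 ^ k.+2))%N => l hl.
have c0 : (0 < (k.+1)`! * 2 ^ k.+2)%N by rewrite muln_gt0 fact_gt0 expn_gt0.
rewrite -(leq_pmul2l c0).
apply: (@leq_trans ((l + 2) ^ k.+1)).
  rewrite [leqRHS]expnS mulnCA mulnA leq_mul //.
  by apply: leq_trans hl _; rewrite leq_addr.
have := expn_le_exp2 k.+1 l.+1; rewrite addn2 => /leq_trans; apply.
rewrite (expnS 2 l) (expnS 2 k.+1).
by move: (_`!)%N (2 ^ k.+1)%N (2 ^ l)%N => x y z; lia.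
Qed.

Section Choice.
Local Open Scope ring_scope.
Variable R : realType.

(** The last level [r0] to be treated on major arcs: [2 ^ r0] is between one
    and two cubes of a logarithm of [P], so that every power of [2 ^ r0] is
    eventually below [P]. *)
Lemma choose_level u v : (4 < u)%N -> exists P0 : nat, forall P, (P0 <= P)%N ->
  (0 < P)%N /\ exists r0 : nat, [/\ harm R (2 * P) ^+ 3 <= 2 ^+ r0,
     2 ^+ (u * r0 + v) <= P%:R :> R & harm R (2 * P) ^+ 15 <= (2 * P)%:R].
Proof.
move=> u4.
have [l0 hl0] := poly_le_exp (u + v).+1 (3 * u).
exists (2 ^ l0)%N => P hP.
have P0 : (0 < P)%N by apply: leq_trans hP; rewrite expn_gt0.
split=> //.
pose l := trunc_log 2 (2 * P).
have P20 : (0 < 2 * P)%N by rewrite muln_gt0.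
have /andP [l1 l2] := trunc_log_bounds (isT : (1 < 2)%N) P20; rewrite -/l in l1 l2.
have l0l : (l0 <= l)%N.
  rewrite -ltnS -(@ltn_exp2l 2) //; apply: leq_ltn_trans l2.
  by apply: leq_trans hP _; rewrite leq_pmull.
have hH : harm R (2 * P) <= (l + 2)%:R.
  by rewrite addn2; apply: le_trans (harm_pow2 R l.+1); apply: harm_le; exact: ltnW.
have L0 : (0 < (l + 2) ^ 3)%N by rewrite expn_gt0 addn2.
have /andP [r1 r2] := trunc_log_bounds (isT : (1 < 2)%N) L0.
set t := trunc_log 2 _ in r1 r2.
have H3 : harm R (2 * P) ^+ 3 <= 2 ^+ t.+1.
  apply: (@le_trans _ _ (((l + 2) ^ 3)%:R)).
    by rewrite natrX lerXn2r ?nnegrE ?harm_ge0.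
  by rewrite -natrX ler_nat ltnW.
have big : (2 ^ (u * t.+1 + v) <= P)%N.
  rewrite -(leq_pmul2l (isT : (0 < 2)%N)); apply: leq_trans l1.
  apply: leq_trans (hl0 _ l0l).
  have -> : (2 * 2 ^ (u * t.+1 + v) = 2 ^ (u + v).+1 * (2 ^ t) ^ u)%N.
    by rewrite -expnS -expnM -expnD; congr expn; lia.
  by rewrite leq_mul2l expnM leq_exp2r ?r1 ?orbT //; lia.
have bigR : 2 ^+ (u * t.+1 + v) <= P%:R :> R by rewrite -natrX ler_nat.
exists t.+1; split => //.
rewrite -[15%N]/(3 * 5)%N exprM.
apply: (@le_trans _ _ ((2 ^+ t.+1) ^+ 5)); first by rewrite lerXn2r ?nnegrE ?exprn_ge0 ?harm_ge0.
rewrite -exprM; apply: (@le_trans _ _ (2 ^+ (u * t.+1 + v))).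
  by rewrite ler_eXn2l ?ltr1n //; nia.
by apply: le_trans bigR _; rewrite ler_nat leq_pmull.
Qed.

End Choice.

(** Arithmetic of exponents for [offdiag_le_arcs], with [32 ^ r = 2 ^ (5 r)].
    *)
Lemma level_exponents r :
  [/\ (15 * r.+1 = 5 * r.+1 * 3)%N, (20 * r.+1 = 5 * r.+1 * 4)%N &
      (10 * r.+1 = 5 * r.+1 * 2)%N] /\
  [/\ (8 + 10 * r.+1 <= 60 * r + 90)%N, (5 + 15 * r.+1 <= 20 * r + 27)%N,
      (7 + 20 * r.+1 <= 20 * r + 27)%N & (2 + (20 * r + 27) * 3 <= 60 * r + 90)%N].
Proof. by split; split; lia. Qed.

Section Pointwise.
Local Open Scope ring_scope.
Variable R : realType.
Implicit Types (b : R).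

Lemma expr_pow_swap (x y : R) r k : (x * y ^+ r) ^+ k = x ^+ k * (y ^+ k) ^+ r.
Proof. by rewrite exprMn -!exprM mulnC. Qed.

(** Cauchy-Schwarz, from the nonnegativity of the quadratic polynomial [F4 - 2
    x F5 + x^2 F6]. *)
Lemma moment5_sqr N P b : moment N 5 P b ^+ 2 <= moment N 4 P b * moment N 6 P b.
Proof.
rewrite /moment; set f := fun i : 'I_N => Normc.normc (cubic_sum P (i%:R / N%:R) b).
have f0 i : 0 <= f i by exact: nc_ge0.
set A := N%:R^-1 * _; set B := N%:R^-1 * _; set C := N%:R^-1 * _.
have A0 : 0 <= A by exact: (moment_ge0 N 5 P b).
have B0 : 0 <= B by exact: (moment_ge0 N 4 P b).
have C0 : 0 <= C by exact: (moment_ge0 N 6 P b).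
have key x : 0 <= B - 2 * x * A + x ^+ 2 * C.
  have -> : B - 2 * x * A + x ^+ 2 * C = N%:R^-1 * \sum_(i < N) (f i ^+ 4 * (1 - x * f i) ^+ 2).
    rewrite /A /B /C !mulrA ![_ * N%:R^-1]mulrC -!mulrA -mulrBr -mulrDr; congr (_ * _).
    rewrite !mulr_sumr -sumrB -big_split /=; apply: eq_bigr => i _; rewrite -/(f i); ring.
  by rewrite mulr_ge0 ?invr_ge0 // sumr_ge0 // => i _; rewrite mulr_ge0 ?sqr_ge0 ?exprn_ge0.
have [C00|Cn] := eqVneq C 0.
  have h := key ((B + 1) / (2 * A)); rewrite C00 !mulr0 addr0 in h *.
  have [->|An] := eqVneq A 0; first by rewrite expr0n.
  have E : 2 * ((B + 1) / (2 * A)) * A = B + 1 by field.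
  by rewrite E in h; lra.
have Cp : 0 < C by rewrite lt_neqAle eq_sym Cn.
have h := key (A / C).
have E : B - 2 * (A / C) * A + (A / C) ^+ 2 * C = (B * C - A ^+ 2) / C by field.
by rewrite E pmulr_lge0 ?invr_gt0 // subr_ge0 in h.
Qed.

Lemma moment5_sup N P b : (0 < N)%N -> (0 < P)%N ->
  exists s : R, [/\ 0 <= s, s ^+ 5 <= 2 ^+ 9 * P%:R ^+ 2 * moment N 4 P b &
    moment N 5 P b <= s * moment N 4 P b].
Proof.
case: N => // N _ P0.
pose f (i : 'I_N.+1) := Normc.normc (cubic_sum P (i%:R / N.+1%:R) b).
have [i _ hi] := @Order.TotalTheory.arg_maxP _ _ _ (ord0 : 'I_N.+1) xpredT f isT.
exists (f i); split; [exact: nc_ge0 | exact: sup_le_fourth |].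
rewrite /moment [leRHS]mulrCA; apply: ler_wpM2l; first by rewrite invr_ge0.
rewrite mulr_sumr; apply: ler_sum => j _.
rewrite [leLHS]exprS ler_wpM2r ?exprn_ge0 ?nc_ge0 //; exact: hi.
Qed.

Lemma offdiag_le_cube P b : Normc.normc (offdiag P b) <= P%:R ^+ 3.
Proof.
apply: le_trans (offdiag_le_rng P b) _.
apply: (@le_trans _ _ (\sum_(h <- rng P) \sum_(k <- rng P) P%:R)).
  by apply: ler_sum => h _; apply: ler_sum => k _; exact: linear_sum_le.
by rewrite !sum_cst !subn1 /= !exprS expr0 mulr1.
Qed.

Lemma level_exists (x : R) : 1 <= x -> exists r : nat, 32 ^+ r <= x < 32 ^+ r.+1.
Proof.
move=> x1.
have [n hn] : exists n, x < 32 ^+ n.+1.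
  exists (Num.truncn x); have /andP [_ h] := Num.Theory.truncn_itv (le_trans ler01 x1).
  apply: lt_le_trans h _; rewrite -natrX ler_nat; apply: ltnW; exact: ltn_expl.
case: (ex_minnP (ex_intro (fun n => x < 32 ^+ n.+1) n hn)) => m hm mmin.
exists m; rewrite hm andbT; case: m mmin hm => [|m] mmin hm; first by rewrite expr0.
by rewrite leNgt; apply/negP => /mmin; rewrite ltnn.
Qed.

(** Base 32 makes the fifth root in [sup_le_fourth] a power of 2. *)
Lemma moment5_level N P b : (P < N)%N -> (0 < P)%N ->
  20 * P%:R ^+ 2 < moment N 4 P b ->
  let A := Normc.normc (offdiag P b) in
  exists r : nat, [/\ A * 32 ^+ r <= P%:R ^+ 3, P%:R ^+ 3 < A * 32 ^+ r.+1 &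
    moment N 5 P b ^+ 2 * 4 ^+ r <= 2 ^+ 16 * P%:R ^+ 2 * A ^+ 2].
Proof.
move=> PN P0 h20 A.
have Pp : 0 < P%:R :> R by rewrite ltr0n.
have P2 : 0 < P%:R ^+ 2 :> R by rewrite exprn_gt0.
have F4A : moment N 4 P b <= 32 * A.
  by have := fourth_moment_le b PN; rewrite -/A; lra.
have A0 : 0 < A by lra.
have x1 : 1 <= P%:R ^+ 3 / A by rewrite ler_pdivlMr // mul1r; exact: offdiag_le_cube.
have [r /andP [r1 r2]] := level_exists x1.
have {}r1 : A * 32 ^+ r <= P%:R ^+ 3 by rewrite mulrC -ler_pdivlMr.
exists r; split => //; first by rewrite mulrC -ltr_pdivrMr.
have [s [s0 s5 hs]] := @moment5_sup N P b (leq_ltn_trans (leq0n _) PN) P0.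
have s2 : s * 2 ^+ r <= 8 * P%:R.
  rewrite -(@ler_pXn2r _ 5) ?nnegrE ?mulr_ge0 ?exprn_ge0 //.
  have -> : (s * 2 ^+ r) ^+ 5 = s ^+ 5 * 32 ^+ r.
    by rewrite expr_pow_swap; congr (_ * _ ^+ _); rewrite !exprS expr0; lra.
  have p0 : 0 <= 32 ^+ r :> R by rewrite exprn_ge0.
  apply: le_trans (ler_wpM2r p0 s5) _.
  have p1 : 0 <= 2 ^+ 9 * P%:R ^+ 2 * 32 ^+ r :> R by rewrite !mulr_ge0 ?exprn_ge0.
  apply: (@le_trans _ _ (2 ^+ 9 * P%:R ^+ 2 * 32 ^+ r * (32 * A))).
    by rewrite mulrAC ler_wpM2l.
  apply: (@le_trans _ _ (2 ^+ 9 * P%:R ^+ 2 * 32 * P%:R ^+ 3)).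
    rewrite (_ : _ * (32 * A) = 2 ^+ 9 * P%:R ^+ 2 * 32 * (A * 32 ^+ r)); last by ring.
    by rewrite ler_wpM2l // !mulr_ge0 ?exprn_ge0.
  have -> : 8 * P%:R = 4 * 2 * P%:R :> R by congr (_ * _); lra.
  rewrite !exprMn (_ : 2 ^+ 9 * _ * 32 * _ = 2 ^+ 9 * 32 * P%:R ^+ 5); last by ring.
  by rewrite ler_wpM2r ?exprn_ge0 // !exprS expr0; lra.
have F5 := moment_ge0 N 5 P b; have F4 := moment_ge0 N 4 P b.
have -> : moment N 5 P b ^+ 2 * 4 ^+ r = (moment N 5 P b * 2 ^+ r) ^+ 2.
  by rewrite expr_pow_swap; congr (_ * _ ^+ _); rewrite !exprS expr0; lra.
have -> : 2 ^+ 16 * P%:R ^+ 2 * A ^+ 2 = (8 * P%:R * (32 * A)) ^+ 2 by ring.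
have p0 : 0 <= 2 ^+ r :> R by rewrite exprn_ge0.
apply: lerXn2r; rewrite ?nnegrE; [exact: mulr_ge0 | by rewrite !mulr_ge0 // ltW |].
apply: le_trans (ler_wpM2r p0 hs) _; rewrite mulrAC ler_pM //.
by rewrite mulr_ge0.
Qed.

(** Bounds both the denominators and the scaled distances that occur at level
    [r]. *)
Definition arc_bound r := (2 ^ (20 * r + 27))%N.

Definition arc_weight (K P q a : nat) b : R :=
  let T := P%:R ^+ 3 * `|6 * b - a%:R / q%:R| in
  if T <= K%:R then (1 + T)^-1 else 0.

(** The arcs are all those around [a / q] that can meet the range [0 <= 6 b <
    6]; they carry the weights of [major_arc]. *)
Definition arcs K P b : R := \sum_(q <- rng K) \sum_(0 <= a < (6 * q).+1)
   tau R q ^+ 2 / q%:R ^+ 2 * arc_weight K P q a b.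

Lemma arc_weight_ge0 K P q a b : 0 <= arc_weight K P q a b.
Proof.
rewrite /arc_weight; case: ifP => // _; rewrite invr_ge0 addr_ge0 // mulr_ge0 // exprn_ge0 //.
Qed.

Lemma arcs_ge0 K P b : 0 <= arcs K P b.
Proof.
apply: sumr_ge0 => q _; apply: sumr_ge0 => a _.
by rewrite mulr_ge0 ?arc_weight_ge0 // divr_ge0 ?exprn_ge0 // sumr_ge0.
Qed.

Lemma reduce_fraction (q : nat) (a : int) : (0 < q)%N ->
  exists (q' : nat) (a' : int), [/\ (0 < q' <= q)%N, coprime q' `|a'|%N &
    a%:~R / q%:R = a'%:~R / q'%:R :> R].
Proof.
move=> q0; pose g := gcdn q `|a|%N.
have g0 : (0 < g)%N by rewrite gcdn_gt0 q0.
have /dvdnP [q' eq'] : (g %| q)%N by exact: dvdn_gcdl.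
have /dvdzP [a' ea'] : (Posz g %| a)%Z by rewrite dvdzE dvdn_gcdr.
have q'0 : (0 < q')%N by case: (posnP q') eq' q0 => // -> ->; rewrite mul0n.
exists q', a'; split.
- by rewrite q'0 eq' leq_pmulr.
- rewrite /coprime -(eqn_pmul2r g0) mul1n muln_gcdl -eq'.
  by rewrite -[X in (_ * X)%N](absz_nat g) -abszM -ea'.
- rewrite [in LHS]eq' ea' natrM intrM -pmulrn; field.
  by rewrite !pnatr_eq0 -!lt0n q'0 g0.
Qed.

(** At level [r] the hypothesis of [rational_approx] holds with density [32 ^
    -(r + 1)]. *)
Lemma offdiag_le_arcs P b r : 0 <= b < 1 -> (0 < P)%N ->
  2 ^+ (60 * r + 90) <= P%:R :> R ->
  P%:R ^+ 3 < Normc.normc (offdiag P b) * 32 ^+ r.+1 ->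
  Normc.normc (offdiag P b) ^+ 2 <= 81 * P%:R ^+ 6 * arcs (arc_bound r) P b.
Proof.
move=> /andP [b0 b1] P0 hP hA.
have [[E15 E20 E10] [I1 I2 I3 I4]] := level_exponents r.
have Pp : 0 < P%:R :> R by rewrite ltr0n.
pose d : R := (32 ^+ r.+1)^-1.
have z0 : 0 < 32 ^+ r.+1 :> R by rewrite exprn_gt0.
have d0 : 0 < d by rewrite invr_gt0.
have dz : d * 32 ^+ r.+1 = 1 by rewrite mulVf // gt_eqF.
have d1 : d <= 1 by rewrite invf_le1 // exprn_ege1 // ler1n.
have z32 : 32 ^+ r.+1 = 2 ^+ (5 * r.+1) :> R by rewrite exprM; congr (_ ^+ _); rewrite !exprS expr0; lra.
set L := \sum_(h <- rng P) \sum_(k <- rng P) linear_sum P (6 * b) h k.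
have AL : Normc.normc (offdiag P b) <= L by exact: offdiag_le_rng.
have hd : 256 <= d ^+ 2 * P%:R.
  have : 256 * 2 ^+ (10 * r.+1) <= P%:R :> R.
    apply: le_trans hP; have -> : 256 = 2 ^+ 8 :> R by rewrite !exprS expr0; lra.
    by rewrite -exprD ler_eXn2l ?ltr1n.
  have e2 : d ^+ 2 * 2 ^+ (10 * r.+1) = 1.
    by rewrite E10 exprM -z32 -exprMn dz expr1n.
  have d2 : 0 <= d ^+ 2 by rewrite exprn_ge0 // ltW.
  by move/(ler_wpM2l d2); rewrite mulrCA e2 mulr1.
have hL : d * P%:R ^+ 3 <= L.
  apply: le_trans AL; rewrite mulrC ler_pdivrMr //; exact: ltW.
have [q [a [q0 qd ha]]] := rational_approx d0 d1 hd hL.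
have [q1 [a1 [/andP [q10 q1q] cop aE]]] := reduce_fraction a q0.
have KE : (arc_bound r)%:R = 2 ^+ (20 * r + 27) :> R by rewrite natrX.
have qp : 0 < q%:R :> R by rewrite ltr0n.
have q1p : 0 < q1%:R :> R by rewrite ltr0n.
have qK : q%:R <= (arc_bound r)%:R :> R.
  have p3 : 0 <= 2 ^+ (15 * r.+1) :> R by rewrite exprn_ge0.
  have := ler_wpM2r p3 qd.
  have -> : q%:R * d ^+ 3 * 2 ^+ (15 * r.+1) = q%:R :> R.
    by rewrite E15 exprM -z32 -mulrA -exprMn dz expr1n mulr1.
  move/le_trans; apply; rewrite KE; have -> : 32 = 2 ^+ 5 :> R by rewrite !exprS expr0; lra.
  by rewrite -exprD ler_eXn2l ?ltr1n.
have q1K : q1%:R <= (arc_bound r)%:R :> R by apply: le_trans qK; rewrite ler_nat.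
pose T := P%:R ^+ 3 * `|6 * b - a1%:~R / q1%:R|.
have T0 : 0 <= T by rewrite mulr_ge0 ?exprn_ge0.
have TK : T <= (arc_bound r)%:R.
  have E : T * q%:R = P%:R ^+ 3 * `|6 * b * q%:R - a%:~R|.
    rewrite /T -aE -mulrA -{2}[q%:R]normr_nat -normrM; congr (_ * `|_|).
    by field; rewrite gt_eqF.
  have p4 : 0 <= 2 ^+ (20 * r.+1) :> R by rewrite exprn_ge0.
  have e4 : d ^+ 4 * 2 ^+ (20 * r.+1) = 1.
    by rewrite E20 exprM -z32 -exprMn dz expr1n.
  have := ler_wpM2r p4 ha.
  have -> : `|6 * b * q%:R - a%:~R| * (d ^+ 4 * P%:R ^+ 3) * 2 ^+ (20 * r.+1) =
     (d ^+ 4 * 2 ^+ (20 * r.+1)) * (P%:R ^+ 3 * `|6 * b * q%:R - a%:~R|) by ring.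
  rewrite e4 mul1r -E => h.
  apply: (@le_trans _ _ (T * q%:R)); first by rewrite ler_peMr // ler1n.
  apply: le_trans h _; rewrite KE; have -> : 128 = 2 ^+ 7 :> R by rewrite !exprS expr0; lra.
  by rewrite -exprD ler_eXn2l ?ltr1n.
have K1 : 1 <= (arc_bound r)%:R :> R by rewrite ler1n expn_gt0.
have K3 : 4 * (arc_bound r)%:R ^+ 3 <= P%:R :> R.
  apply: le_trans hP; rewrite KE -exprM; have -> : 4 = 2 ^+ 2 :> R by rewrite !exprS expr0; lra.
  by rewrite -exprD ler_eXn2l ?ltr1n.
set K : R := (arc_bound r)%:R in KE qK q1K TK K1 K3 *.
have majorP : 2 * q1%:R ^+ 2 * (1 + T) <= P%:R.
  apply: le_trans K3.
  have -> : 4 * K ^+ 3 = 2 * K ^+ 2 * (2 * K) by ring.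
  apply: ler_pM; rewrite ?mulr_ge0 ?exprn_ge0 //; [lra | | lra].
  by rewrite ler_wpM2l // lerXn2r ?nnegrE //; lra.
have M := major_arc q10 cop majorP; rewrite -/L -/T in M.
have A2 : Normc.normc (offdiag P b) ^+ 2 <= L ^+ 2 by rewrite lerXn2r ?nnegrE ?nc_ge0 // (le_trans _ AL) ?nc_ge0.
apply: le_trans A2 _; apply: le_trans M _.
rewrite ler_wpM2l ?mulr_ge0 ?exprn_ge0 //.
(* Since [0 <= 6 b < 6], this confines the numerator to [0, ..., 6 q]. *)
have small : `|6 * b * q1%:R - a1%:~R| < 1.
  have E : T * q1%:R = P%:R ^+ 3 * `|6 * b * q1%:R - a1%:~R|.
    rewrite /T -mulrA -{2}[q1%:R]normr_nat -normrM; congr (_ * `|_|).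
    by field; rewrite gt_eqF.
  have P3 : 0 < P%:R ^+ 3 :> R by rewrite exprn_gt0.
  have PP : P%:R <= P%:R ^+ 3 :> R by rewrite exprS ler_peMr // exprn_ege1 // ler1n.
  rewrite -(ltr_pM2l P3) -E mulr1; apply: (@le_lt_trans _ _ (K * K)); first by rewrite ler_pM.
  apply: lt_le_trans PP; apply: lt_le_trans K3.
  have : K * K <= K * K * K by rewrite ler_peMr // mulr_ge0 //; lra.
  have : 0 < K * K by rewrite mulr_gt0 //; lra.
  by rewrite !exprS expr0; lra.
have bq : 0 <= 6 * b * q1%:R by rewrite !mulr_ge0.
have bq1 : 6 * b * q1%:R < 6 * q1%:R.
  by rewrite -mulrA ltr_pM2l // -[ltRHS]mul1r ltr_pM2r.
case: a1 => [n|n] in cop aE @T T0 TK majorP small *; last first.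
  move: small; rewrite NegzE mulrNz opprK ltr_norml => /andP [_].
  by rewrite -pmulrn -natr1; have := ler0n R n; lra.
rewrite -pmulrn in T T0 TK majorP small *.
have nq : (n < (6 * q1).+1)%N.
  move: small; rewrite ltr_norml => /andP [h _].
  by rewrite -(ltr_nat R) -natr1 natrM; lra.
have q1in : q1 \in rng (arc_bound r) by rewrite mem_rng q10 -(ler_nat R).
rewrite /arcs (bigD1_seq q1) ?iota_uniq //= (bigD1_seq n) ?iota_uniq ?mem_index_iota //=.
rewrite -addrA ler_wpDr //.
  rewrite addr_ge0 // sumr_ge0 // => x _; last apply: sumr_ge0 => y _;
  by rewrite mulr_ge0 ?arc_weight_ge0 // divr_ge0 ?exprn_ge0 // sumr_ge0.
by rewrite /arc_weight -/T TK invfM mulrA.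
Qed.

End Pointwise.

(** * Averages over the last variable *)

Section Averages.
Local Open Scope ring_scope.
Variable R : realType.
Implicit Types (b x L : R).

(** The [+ 1] is harmless below, where [L] is [N / (6 P^3)] and [N] exceeds
    [P^3]. *)
Lemma count_interval N x L : 0 <= L ->
  \sum_(j < N) (x <= j%:R <= x + L)%R%:R <= L + 1.
Proof.
move=> L0.
rewrite -(big_mkord predT (fun j => (x <= j%:R <= x + L)%R%:R)) -(size_filter_sum R (fun j : nat => x <= j%:R <= x + L)).
set s := [seq _ <- _ | _].
have /andP [t1 t2] := Num.Theory.truncn_itv L0.
suff h : (size s <= (Num.truncn L).+1)%N.
  apply: (@le_trans _ _ (Num.truncn L).+1%:R); first by rewrite ler_nat.
  by rewrite -natr1 lerD2r.
have [->|sn] := eqVneq s [::]; first by [].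
have [j0 j0s] : exists j, j \in s by case: (s) sn => // c l _; exists c; exact: mem_head.
case: (ex_minnP (ex_intro (fun j => j \in s) j0 j0s)) => m ms mmin.
rewrite -(size_iota m (Num.truncn L).+1); apply: uniq_leq_size; first by rewrite filter_uniq ?iota_uniq.
move=> j js; rewrite mem_iota (mmin _ js) /= addnS ltnS.
move: ms js; rewrite !mem_filter => /andP [/andP [m1 _] _] /andP [/andP [_ j2] _].
rewrite -ltnS -addnS -(ltr_nat R) natrD; lra.
Qed.

(** Sort the points by the integer part [t] of the scaled distance [T]: they
    lie in two intervals of length [1 / (6 P^3)], one on each side of the
    centre, and have weight at most [1 / (t + 1)]. *)
Lemma arc_weight_average N K P q a : (0 < P)%N -> (P ^ 3 <= N)%N ->
  N%:R^-1 * \sum_(j < N) arc_weight K P q a (j%:R / N%:R : R) <= 3 / P%:R ^+ 3 * harm R K.+1.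
Proof.
move=> P0 PN.
have Pp : 0 < P%:R :> R by rewrite ltr0n.
have P3 : 0 < P%:R ^+ 3 :> R by rewrite exprn_gt0.
have PNR : P%:R ^+ 3 <= N%:R :> R by rewrite -natrX ler_nat.
have Np : 0 < N%:R :> R by exact: lt_le_trans PNR.
pose L : R := N%:R / (6 * P%:R ^+ 3).
have L0 : 0 <= L by rewrite divr_ge0 // mulr_ge0 // ltW.
pose x t : R := N%:R / 6 * (a%:R / q%:R + t%:R / P%:R ^+ 3).
pose y t : R := N%:R / 6 * (a%:R / q%:R - t.+1%:R / P%:R ^+ 3).
have bound (j : 'I_N) : arc_weight K P q a (j%:R / N%:R : R) <= \sum_(t < K.+1) t.+1%:R^-1 *
    ((x t <= j%:R <= x t + L)%R%:R + (y t <= j%:R <= y t + L)%R%:R).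
  rewrite /arc_weight; set T := _ * `|_|.
  have pos (t : 'I_K.+1) : 0 <= t.+1%:R^-1 *
    ((x t <= j%:R <= x t + L)%R%:R + (y t <= j%:R <= y t + L)%R%:R).
    by rewrite mulr_ge0 ?invr_ge0 // addr_ge0.
  have T0 : 0 <= T by rewrite mulr_ge0 // ltW.
  case: ifP => [TK|_]; last by apply: sumr_ge0.
  have /andP [t1 t2] := Num.Theory.truncn_itv T0; set t := Num.Def.trunc T in t1 t2.
  have tK : (t < K.+1)%N by rewrite ltnS -(ler_nat R); exact: le_trans t1 TK.
  rewrite (bigD1 (Ordinal tK)) //= ler_wpDr //; first by apply: sumr_ge0 => i _; exact: pos.
  have tp : 0 < t.+1%:R :> R by rewrite ltr0n.
  suff h : 1 <= (x t <= j%:R <= x t + L)%R%:R + (y t <= j%:R <= y t + L)%R%:R :> R.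
    apply: (@le_trans _ _ (t.+1%:R^-1 * 1)); last by rewrite ler_wpM2l // invr_ge0.
    rewrite mulr1 lef_pV2 ?posrE //; first by rewrite -natr1; lra.
    by lra.
  have xE : x t = N%:R / 6 * (a%:R / q%:R) + t%:R * L by rewrite /x /L; set z := a%:R / q%:R; field; rewrite gt_eqF.
  have yE : y t = N%:R / 6 * (a%:R / q%:R) - t.+1%:R * L by rewrite /y /L; set z := a%:R / q%:R; field; rewrite gt_eqF.
  have jE : j%:R = N%:R / 6 * (a%:R / q%:R) + (P%:R ^+ 3 * (6 * (j%:R / N%:R) - a%:R / q%:R)) * L.
    rewrite /L; set z := a%:R / q%:R; field; rewrite !gt_eqF //.
  have [hs|hs] := lerP 0 (6 * (j%:R / N%:R : R) - a%:R / q%:R).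
    have TE : T = P%:R ^+ 3 * (6 * (j%:R / N%:R) - a%:R / q%:R) by rewrite /T ger0_norm.
    have -> : x t <= j%:R <= x t + L.
      rewrite xE jE -TE; have := ler_wpM2r L0 t1; have := ler_wpM2r L0 (ltW t2).
      by rewrite -natr1 => h1 h2; apply/andP; split; lra.
    by rewrite lerDl.
  have TE : - T = P%:R ^+ 3 * (6 * (j%:R / N%:R) - a%:R / q%:R) by rewrite /T ltr0_norm // mulrN opprK.
  have -> : y t <= j%:R <= y t + L.
    rewrite yE jE -TE; have := ler_wpM2r L0 t1; have := ler_wpM2r L0 (ltW t2).
    by rewrite -natr1 => h1 h2; apply/andP; split; lra.
  by rewrite lerDr.
apply: (@le_trans _ _ (N%:R^-1 * \sum_(j < N) \sum_(t < K.+1) t.+1%:R^-1 *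
    ((x t <= j%:R <= x t + L)%R%:R + (y t <= j%:R <= y t + L)%R%:R))).
  by rewrite ler_wpM2l ?invr_ge0 //; apply: ler_sum => j _.
rewrite exchange_big /=.
apply: (@le_trans _ _ (N%:R^-1 * \sum_(t < K.+1) t.+1%:R^-1 * (2 * (L + 1)))).
  rewrite ler_wpM2l ?invr_ge0 //; apply: ler_sum => t _.
  rewrite -mulr_sumr ler_wpM2l ?invr_ge0 // big_split /=.
  by have := count_interval N (x t) L0; have := count_interval N (y t) L0; lra.
rewrite -mulr_suml mulrCA mulrC.
have -> : \sum_(t < K.+1) t.+1%:R^-1 = harm R K.+1 by rewrite /harm big_add1 big_mkord.
rewrite ler_wpM2r ?harm_ge0 // ler_pdivlMr // -mulrA ler_pdivrMl //.
have LP : L * P%:R ^+ 3 = N%:R / 6 by rewrite /L; field; rewrite gt_eqF.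
lra.
Qed.

Lemma harm_arc_bound r : harm R (arc_bound r).+1 <= (20 * r + 29)%:R.
Proof.
apply: le_trans (harm_le R (_ : _ <= 2 ^ (20 * r + 28))%N) _.
  have -> : (20 * r + 28 = (20 * r + 27).+1)%N by rewrite addnS.
  by rewrite /arc_bound expnS mul2n -addnn -addn1 leq_add2l expn_gt0.
by apply: le_trans (harm_pow2 R _) _; rewrite ler_nat; lia.
Qed.

(** There are at most [6 q + 1] numerators for each [q], and this turns the
    weights into those of [sum_tau_sqr]. *)
Lemma arcs_average N P r : (0 < P)%N -> (P ^ 3 <= N)%N ->
  N%:R^-1 * \sum_(j < N) arcs (arc_bound r) P (j%:R / N%:R : R) <=
    21 / P%:R ^+ 3 * (20 * r + 29)%:R ^+ 5.
Proof.
move=> P0 PN; set K := arc_bound r.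
have Pp : 0 < P%:R :> R by rewrite ltr0n.
have P3 : 0 < P%:R ^+ 3 :> R by rewrite exprn_gt0.
have H0 := @harm_ge0 R K.+1; have HK0 := @harm_ge0 R K.
have t0 q : 0 <= tau R q ^+ 2 / q%:R ^+ 2 by rewrite divr_ge0 ?exprn_ge0 // sumr_ge0.
have -> : N%:R^-1 * \sum_(j < N) arcs K P (j%:R / N%:R : R) =
    \sum_(q <- rng K) \sum_(0 <= a < (6 * q).+1) tau R q ^+ 2 / q%:R ^+ 2 *
      (N%:R^-1 * \sum_(j < N) arc_weight K P q a (j%:R / N%:R : R)).
  rewrite exchange_big mulr_sumr; apply: eq_bigr => q _.
  rewrite exchange_big mulr_sumr; apply: eq_bigr => a _.
  by rewrite -mulr_sumr mulrCA.
apply: (@le_trans _ _ (\sum_(q <- rng K) tau R q ^+ 2 / q%:R * (21 / P%:R ^+ 3 * harm R K.+1))).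
  rewrite big_seq [leRHS]big_seq; apply: ler_sum => q; rewrite mem_rng => /andP [q0 _].
  apply: (@le_trans _ _ (\sum_(0 <= a < (6 * q).+1) tau R q ^+ 2 / q%:R ^+ 2 *
      (3 / P%:R ^+ 3 * harm R K.+1))).
    by apply: ler_sum => a _; rewrite ler_wpM2l //; exact: arc_weight_average.
  have qp : 0 < q%:R :> R by rewrite ltr0n.
  rewrite sum_cst subn0.
  have -> : tau R q ^+ 2 / q%:R * (21 / P%:R ^+ 3 * harm R K.+1) =
     (7 * q%:R) * (tau R q ^+ 2 / q%:R ^+ 2 * (3 / P%:R ^+ 3 * harm R K.+1)).
    by field; rewrite !gt_eqF.
  rewrite ler_wpM2r //; last by rewrite -natrM ler_nat; lia.
  by rewrite mulr_ge0 // mulr_ge0 // divr_ge0 // ltW.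
rewrite -mulr_suml; set S := \sum_(_ <- _) _.
rewrite (_ : S * _ = 21 / P%:R ^+ 3 * (harm R K.+1 * S)); last by ring.
rewrite ler_wpM2l //.
apply: (@le_trans _ _ (harm R K.+1 * harm R K.+1 ^+ 4)).
  rewrite ler_wpM2l //; apply: le_trans (sum_tau_sqr R K) _.
  by rewrite lerXn2r ?nnegrE // harm_le.
by rewrite -exprS lerXn2r ?nnegrE ?ler0n ?harm_arc_bound.
Qed.

(** The fifth power stands for five harmonic sums up to about [arc_bound r],
    each linear in [r]. *)
Lemma level_sum r0 : \sum_(r < r0) (4 ^+ r)^-1 * (20 * r + 29)%:R ^+ 5 <=
   29 ^+ 5 * 120 * 2 ^+ 6 :> R.
Proof.
have bd (r : nat) : (4 ^+ r)^-1 * (20 * r + 29)%:R ^+ 5 <= 29 ^+ 5 * 120 * 2 ^+ 5 * (2 ^+ r)^-1 :> R.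
  have p4 : 0 < 4 ^+ r :> R by rewrite exprn_gt0.
  have p2 : 0 < 2 ^+ r :> R by rewrite exprn_gt0.
  rewrite ler_pdivrMl //.
  have -> : 4 ^+ r = 2 ^+ r * 2 ^+ r :> R by rewrite -exprMn; congr (_ ^+ _); lra.
  rewrite [leRHS](_ : _ = 29 ^+ 5 * (120 * 2 ^+ 5 * 2 ^+ r)); last by field; rewrite gt_eqF.
  apply: (@le_trans _ _ (29 ^+ 5 * r.+1%:R ^+ 5)).
    by rewrite -exprMn lerXn2r ?nnegrE // -natrM ler_nat; lia.
  rewrite ler_wpM2l ?exprn_ge0 //.
  have := expn_le_exp2 5 r; have -> : (5`! = 120)%N by [].
  by rewrite -(ler_nat R) natrM natrM !natrX.
apply: (@le_trans _ _ (\sum_(r < r0) 29 ^+ 5 * 120 * 2 ^+ 5 * (2 ^+ r)^-1)).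
  by apply: ler_sum => r _; exact: bd.
rewrite -mulr_sumr [2 ^+ 6]exprSr mulrA ler_wpM2l ?mulr_ge0 ?exprn_ge0 //.
suff -> : \sum_(r < r0) (2 ^+ r)^-1 = 2 - 2 / 2 ^+ r0 :> R.
  by rewrite lerBlDr lerDl divr_ge0 // exprn_ge0.
elim: r0 => [|r IH]; first by rewrite big_ord0 expr0; lra.
by rewrite big_ord_recr /= IH exprS; field; rewrite gt_eqF // exprn_gt0.
Qed.

(** The three terms correspond to a diagonal fourth moment, to the levels from
    [r0] on, and to those below [r0]. *)
Lemma moment5_pointwise N P r0 b : (P < N)%N -> (0 < P)%N -> 0 <= b < 1 ->
  2 ^+ (60 * r0 + 90) <= P%:R :> R ->
  moment N 5 P b ^+ 2 <= 20 * P%:R ^+ 2 * moment N 6 P b +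
    2 ^+ 16 * P%:R ^+ 2 * (4 ^+ r0)^-1 * Normc.normc (offdiag P b) ^+ 2 +
    \sum_(r < r0) 2 ^+ 16 * P%:R ^+ 2 * (4 ^+ r)^-1 * (81 * P%:R ^+ 6 * arcs (arc_bound r) P b).
Proof.
move=> PN P0 hb hP.
have p1 : 0 <= 20 * P%:R ^+ 2 * moment N 6 P b.
  by rewrite mulr_ge0 ?moment_ge0 // mulr_ge0 ?exprn_ge0.
have p2 : 0 <= 2 ^+ 16 * P%:R ^+ 2 * (4 ^+ r0)^-1 * Normc.normc (offdiag P b) ^+ 2.
  by rewrite !mulr_ge0 ?invr_ge0 ?exprn_ge0 ?nc_ge0.
have p3 (r : nat) : 0 <= 2 ^+ 16 * P%:R ^+ 2 * (4 ^+ r)^-1 * (81 * P%:R ^+ 6 * arcs (arc_bound r) P b).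
  by rewrite !mulr_ge0 ?invr_ge0 ?exprn_ge0 ?arcs_ge0.
have p3s : 0 <= \sum_(r < r0) 2 ^+ 16 * P%:R ^+ 2 * (4 ^+ r)^-1 * (81 * P%:R ^+ 6 * arcs (arc_bound r) P b).
  by apply: sumr_ge0.
case: (leP (moment N 4 P b) (20 * P%:R ^+ 2)) => h4.
  rewrite -addrA ler_wpDr ?addr_ge0 //; apply: le_trans (moment5_sqr N P b) _.
  by rewrite ler_wpM2r ?moment_ge0.
have [r [r1 r2 r3]] := moment5_level PN P0 h4.
have q4 m : 0 < 4 ^+ m :> R by rewrite exprn_gt0.
have {}r3 : moment N 5 P b ^+ 2 <= 2 ^+ 16 * P%:R ^+ 2 * (4 ^+ r)^-1 * Normc.normc (offdiag P b) ^+ 2.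
  by rewrite mulrAC ler_pdivlMr.
case: (leqP r0 r) => rr0.
  rewrite addrAC -addrA ler_wpDl // ?addr_ge0 // ?ler_wpDl //.
  apply: le_trans r3 _; rewrite ler_wpM2r ?exprn_ge0 ?nc_ge0 // ler_wpM2l ?mulr_ge0 ?exprn_ge0 //.
  by rewrite lef_pV2 ?posrE // ler_eXn2l ?ltr1n.
rewrite ler_wpDl ?addr_ge0 // (bigD1 (Ordinal rr0)) //= ler_wpDr ?sumr_ge0 //.
apply: le_trans r3 _; rewrite ler_wpM2l ?mulr_ge0 ?invr_ge0 ?exprn_ge0 //.
apply: offdiag_le_arcs => //; apply: le_trans hP.
by rewrite ler_eXn2l ?ltr1n //; lia.
Qed.

Definition upper_const : R :=
  20 * 27 * 8 + 2 ^+ 16 * 8 + 2 ^+ 16 * 81 * 21 * (29 ^+ 5 * 120 * 2 ^+ 6).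

(** The condition on [N] makes orthogonality exact for all frequencies that
    occur, and the points [j / N] finer than the narrowest arcs. *)
Lemma discrete_upper : exists P0 : nat, forall P N, (P0 <= P)%N -> (6 * P ^ 3 < N)%N ->
  N%:R^-1 * \sum_(j < N) moment N 5 P (j%:R / N%:R : R) ^+ 2 <= upper_const * P%:R ^+ 5.
Proof.
have [P0 hP0] := @choose_level R 60 90 isT.
exists P0 => P N /hP0 [Pg [r0 [H3 hP H15]]] PN.
have PP3 : (P <= P ^ 3)%N by rewrite -{1}[P]expn1 leq_pexp2l.
have [PN1 PN2 PN3] : [/\ P < N, 3 * P ^ 3 < N & P ^ 3 <= N]%N by split; lia.
have Pp : 0 < P%:R :> R by rewrite ltr0n.
have Np : 0 < N%:R :> R by rewrite ltr0n; lia.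
have q4 m : 0 < 4 ^+ m :> R by rewrite exprn_gt0.
pose X := fun j : 'I_N => (j%:R / N%:R : R).
have X01 j : 0 <= X j < 1 by rewrite divr_ge0 //= ltr_pdivrMr // mul1r ltr_nat.
pose F6 (j : 'I_N) := 20 * P%:R ^+ 2 * moment N 6 P (X j).
pose FA (j : 'I_N) := 2 ^+ 16 * P%:R ^+ 2 * (4 ^+ r0)^-1 * Normc.normc (offdiag P (X j)) ^+ 2.
pose FM (j : 'I_N) := \sum_(r < r0) 2 ^+ 16 * P%:R ^+ 2 * (4 ^+ r)^-1 *
  (81 * P%:R ^+ 6 * arcs (arc_bound r) P (X j)).
have b1 : N%:R^-1 * \sum_(j < N) F6 j <= 20 * 27 * 8 * P%:R ^+ 5.
  rewrite -mulr_sumr mulrCA (sixth_moment R PN2).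
  have h : (size (equal_sum_cubes P))%:R <= 27 * (2 * P%:R) ^+ 3 :> R.
    apply: (@le_trans _ _ (size (equal_sum_prod (2 * P)))%:R); first by rewrite ler_nat size_equal_sum_cubes.
    by rewrite -natrM; apply: size_equal_sum_prod_le H15; rewrite muln_gt0.
  have c0 : 0 <= 20 * P%:R ^+ 2 :> R by rewrite mulr_ge0 ?exprn_ge0.
  apply: le_trans (ler_wpM2l c0 h) _.
  by rewrite le_eqVlt; apply/orP; left; apply/eqP; ring.
have b2 : N%:R^-1 * \sum_(j < N) FA j <= 2 ^+ 16 * 8 * P%:R ^+ 5.
  rewrite -mulr_sumr mulrCA.
  have hM := second_moment_offdiag R PN; set M := N%:R^-1 * _ in hM *.
  have M1 : M <= (2 * P%:R) ^+ 3 * 4 ^+ r0.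
    apply: le_trans hM _; have ht := size_triples_le R (2 * P).
    apply: (@le_trans _ _ ((2 * P%:R * harm R (2 * P) ^+ 2) ^+ 3)).
      by rewrite -natrM lerXn2r ?nnegrE // mulr_ge0 ?exprn_ge0 ?harm_ge0.
    rewrite exprMn ler_wpM2l ?exprn_ge0 ?mulr_ge0 //.
    have -> : (harm R (2 * P) ^+ 2) ^+ 3 = (harm R (2 * P) ^+ 3) ^+ 2 by rewrite -!exprM.
    have -> : 4 ^+ r0 = (2 ^+ r0) ^+ 2 :> R.
      by rewrite -exprM mulnC exprM; congr (_ ^+ _); rewrite expr2; lra.
    by rewrite lerXn2r ?nnegrE ?exprn_ge0 ?harm_ge0.
  have c0 : 0 <= 2 ^+ 16 * P%:R ^+ 2 * (4 ^+ r0)^-1 :> R by rewrite !mulr_ge0 ?invr_ge0 ?exprn_ge0.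
  apply: le_trans (ler_wpM2l c0 M1) _.
  rewrite le_eqVlt; apply/orP; left; apply/eqP; move: (2 ^+ 16) => c; field; rewrite gt_eqF //.
have b3 : N%:R^-1 * \sum_(j < N) FM j <= 2 ^+ 16 * 81 * 21 * (29 ^+ 5 * 120 * 2 ^+ 6) * P%:R ^+ 5.
  rewrite exchange_big mulr_sumr.
  apply: (@le_trans _ _ (\sum_(r < r0) 2 ^+ 16 * 81 * 21 * P%:R ^+ 5 *
     ((4 ^+ r)^-1 * (20 * r + 29)%:R ^+ 5))).
    apply: ler_sum => r _; rewrite -!mulr_sumr.
    have c0 : 0 <= 2 ^+ 16 * P%:R ^+ 2 * (4 ^+ r)^-1 * (81 * P%:R ^+ 6) :> R.
      by rewrite !mulr_ge0 ?invr_ge0 ?exprn_ge0.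
    rewrite [X in N%:R^-1 * X]mulrA mulrCA; apply: le_trans (ler_wpM2l c0 (arcs_average r Pg PN3)) _.
    rewrite le_eqVlt; apply/orP; left; apply/eqP; move: (2 ^+ 16) ((20 * r + 29)%:R) => c m; field.
    by rewrite !gt_eqF.
  rewrite -mulr_sumr [leRHS]mulrAC; apply: ler_wpM2l; last exact: level_sum.
  by rewrite !mulr_ge0 ?exprn_ge0.
apply: le_trans (_ : _ <= N%:R^-1 * \sum_(j < N) (F6 j + FA j + FM j)) _.
  rewrite ler_wpM2l ?invr_ge0 ?ler0n //; apply: ler_sum => j _.
  exact: (moment5_pointwise PN1 Pg (X01 j) hP).
rewrite !big_split /= !mulrDr; apply: le_trans (lerD (lerD b1 b2) b3) _.
by rewrite /upper_const [leRHS]mulrDl [X in _ <= X + _]mulrDl.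
Qed.

Lemma second_moment N P b : (P < N)%N -> moment N 2 P b = P%:R.
Proof.
move=> PN.
have := @parseval R _ (rng P) (fun x : nat => e2pi (b * x%:R ^+ 3)) id N.
rewrite /moment => pv.
have E (i : 'I_N) : cubic_sum P (i%:R / N%:R : R) b =
    \sum_(x <- rng P) e2pi (b * x%:R ^+ 3) * e2pi (i%:R / N%:R * x%:R).
  by apply: eq_bigr => x _; rewrite -e_add addrC.
under eq_bigr do rewrite E.
rewrite pv; last by move=> x; rewrite mem_rng /=; lia.
rewrite (eq_big_seq (fun=> 1)); first by rewrite sum_cst subn1 mulr1.
move=> x xP; rewrite (bigD1_seq x) ?iota_uniq // eqxx mul1r big1.
  by apply: (etrans (addr0 _)); rewrite -nc_sqr nc_e expr1n.
by move=> y /negPf yx; rewrite eq_sym yx mul0r.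
Qed.

Lemma moment5_lower N P b : (P < N)%N -> P%:R ^+ 5 <= moment N 5 P b ^+ 2.
Proof.
move=> PN.
have Np : 0 < N%:R :> R by rewrite ltr0n; lia.
have F2 := second_moment b PN.
pose f (i : 'I_N) := Normc.normc (cubic_sum P (i%:R / N%:R : R) b).
have f0 i : 0 <= f i by exact: nc_ge0.
have dbl k : moment N k P b ^+ 2 = N%:R^-1 ^+ 2 * \sum_(i < N) \sum_(j < N) (f i * f j) ^+ k.
  rewrite /moment exprMn; congr (_ * _); rewrite expr2 mulr_suml; apply: eq_bigr => i _.
  by rewrite mulr_sumr; apply: eq_bigr => j _; rewrite exprMn.
(* The graph of [x^(5/2)] lies above its tangent at [x = t^2]; here [x = g^2]. *)
have conv (g t : R) : 0 <= g -> 0 <= t -> 5 * t ^+ 3 * g ^+ 2 - 3 * t ^+ 5 <= 2 * g ^+ 5.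
  move=> g0 t0; rewrite -subr_ge0.
  have -> : 2 * g ^+ 5 - (5 * t ^+ 3 * g ^+ 2 - 3 * t ^+ 5) =
    (g - t) ^+ 2 * (2 * g ^+ 3 + 4 * g ^+ 2 * t + 6 * g * t ^+ 2 + 3 * t ^+ 3) by ring.
  by rewrite mulr_ge0 ?sqr_ge0 // !addr_ge0 // !mulr_ge0 // ?exprn_ge0.
have : N%:R^-1 ^+ 2 * \sum_(i < N) \sum_(j < N) (5 * P%:R ^+ 3 * (f i * f j) ^+ 2 - 3 * P%:R ^+ 5) <=
    N%:R^-1 ^+ 2 * \sum_(i < N) \sum_(j < N) 2 * (f i * f j) ^+ 5.
  rewrite ler_wpM2l ?exprn_ge0 ?invr_ge0 ?ler0n //; apply: ler_sum => i _; apply: ler_sum => j _.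
  by apply: conv => //; rewrite mulr_ge0.
have -> : \sum_(i < N) \sum_(j < N) 2 * (f i * f j) ^+ 5 = 2 * \sum_(i < N) \sum_(j < N) (f i * f j) ^+ 5.
  by rewrite mulr_sumr; apply: eq_bigr => i _; rewrite mulr_sumr.
rewrite [leRHS]mulrCA -dbl.
have -> : \sum_(i < N) \sum_(j < N) (5 * P%:R ^+ 3 * (f i * f j) ^+ 2 - 3 * P%:R ^+ 5) =
  5 * P%:R ^+ 3 * (\sum_(i < N) \sum_(j < N) (f i * f j) ^+ 2) - N%:R ^+ 2 * (3 * P%:R ^+ 5).
  rewrite mulr_sumr (eq_bigr (fun i => 5 * P%:R ^+ 3 * (\sum_(j < N) (f i * f j) ^+ 2) - N%:R * (3 * P%:R ^+ 5))).
    by rewrite sumrB sumr_const card_ord -[_ *+ N]mulr_natl; congr (_ - _); ring.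
  by move=> i _; rewrite sumrB mulr_sumr sumr_const card_ord -[_ *+ N]mulr_natl.
rewrite mulrBr mulrCA -dbl F2 [X in _ - X]mulrA -exprMn mulVf ?gt_eqF // expr1n mul1r.
have : 5 * P%:R ^+ 3 * P%:R ^+ 2 = 5 * P%:R ^+ 5 :> R by ring.
lra.
Qed.

Lemma discrete_lower N P : (P < N)%N ->
  P%:R ^+ 5 <= N%:R^-1 * \sum_(j < N) moment N 5 P (j%:R / N%:R : R) ^+ 2.
Proof.
move=> PN; have Np : 0 < N%:R :> R by rewrite ltr0n; lia.
rewrite ler_pdivlMl // mulr_natl -[X in _ *+ X]card_ord -sumr_const.
by apply: ler_sum => j _; exact: moment5_lower.
Qed.

End Averages.

(** * From sums to integrals *)

Section Riemann.
Local Open Scope classical_set_scope.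
Local Open Scope ring_scope.
Variable R : realType.

Lemma integral_cells d (T : measurableType d) (mu : {measure set T -> \bar R})
    (I : finType) (F : I -> set T) (D : set T) (g : T -> R) (v : I -> R) (c eps : R) :
  (forall i, measurable (F i)) -> (forall i j, i != j -> F i `&` F j = set0) ->
  D = [set x | exists i, F i x] -> (forall i, mu (F i) = c%:E) -> 0 <= c ->
  measurable_fun setT g -> (forall x, 0 <= g x) ->
  (forall i x, F i x -> `|g x - v i| <= eps) ->
  ((\sum_i (v i - eps) * c)%:E <= \int[mu]_(x in D) (g x)%:E)%E /\
  (\int[mu]_(x in D) (g x)%:E <= (\sum_i (v i + eps) * c)%:E)%E.
Proof.
move=> mF dF DE muF c0 mg g0 gv.
have {}DE : D = \big[setU/set0]_(i <- index_enum I) F i.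
  rewrite -bigcup_seq DE; apply/seteqP; split => [x [j Fx]|x [j _ Fx]]; last by exists j.
  by exists j => //=; rewrite mem_index_enum.
have tF : trivIset [set` index_enum I] F by apply/trivIsetP => i j _ _; exact: dF.
have mG A : measurable_fun A (fun x => (g x)%:E).
  by apply/measurable_EFinP; exact: measurable_funTS.
have -> : (\int[mu]_(x in D) (g x)%:E = \sum_i \int[mu]_(x in F i) (g x)%:E)%E.
  rewrite DE ge0_integral_bigsetU ?index_enum_uniq //.
  by move=> x _; rewrite lee_fin.
have cst_int (r : R) i : (\int[mu]_(x in F i) (cst r%:E) x = (r * c)%:E)%E.
  by rewrite integral_cst // muF -EFinM.
rewrite -!sumEFin; split.
  apply: lee_sum => i _.
  have [ve|ve] := leP 0 (v i - eps); last first.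
    apply: (@le_trans _ _ 0%E); first by rewrite lee_fin mulr_le0_ge0 // ltW.
    by apply: integral_ge0 => x _; rewrite lee_fin.
  rewrite -(cst_int _ i); apply: ge0_le_integral => //.
  by move=> x /gv; rewrite ler_norml lee_fin => /andP []; lra.
apply: lee_sum => i _; rewrite -(cst_int _ i); apply: ge0_le_integral => //.
- by move=> x _; rewrite lee_fin.
- by move=> x /gv; rewrite ler_norml lee_fin => /andP []; lra.
Qed.

Definition cell (N i : nat) : set R := `[i%:R / N%:R, i.+1%:R / N%:R[.

Lemma measurable_cell N i : measurable (cell N i).
Proof. exact: measurable_itv. Qed.

Lemma cell_dist N i x : (0 < N)%N -> cell N i x -> `|x - i%:R / N%:R| <= N%:R^-1.
Proof.
move=> N0; rewrite /cell /= in_itv /= => /andP [h1 h2].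
have E : i.+1%:R / N%:R = i%:R / N%:R + N%:R^-1 :> R by rewrite -natr1 mulrDl mul1r.
by rewrite ger0_norm ?subr_ge0 //; rewrite E in h2; lra.
Qed.

Lemma cell_disjoint N i j : (0 < N)%N -> i != j -> cell N i `&` cell N j = set0.
Proof.
move=> N0; have Np : 0 < N%:R :> R by rewrite ltr0n.
wlog : i j / (i < j)%N.
  move=> H ij; have := ij; rewrite neq_ltn => /orP [lt|lt]; first exact: H.
  by rewrite setIC; apply: H => //; rewrite eq_sym.
move=> ij _; apply/seteqP; split => // x []; rewrite /cell /= !in_itv /= => /andP [_ h1] /andP [h2 _].
have : i.+1%:R / N%:R <= j%:R / N%:R :> R by rewrite ler_pM2r ?invr_gt0 // ler_nat.
by move=> h; have := lt_le_trans h1 (le_trans h h2); rewrite ltxx.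
Qed.

Lemma cell_cover N x : (0 < N)%N -> `[0, 1[%classic x <-> exists i : 'I_N, cell N i x.
Proof.
move=> N0; have Np : 0 < N%:R :> R by rewrite ltr0n.
rewrite /= in_itv /=; split => [/andP [x0 x1]|[k]]; last first.
  rewrite /cell /= in_itv /= => /andP [h1 h2]; apply/andP; split.
    by apply: le_trans h1; rewrite divr_ge0.
  by apply: lt_le_trans h2 _; rewrite ler_pdivrMr // mul1r ler_nat.
have y0 : 0 <= N%:R * x by rewrite mulr_ge0 // ltW.
have /andP [t1 t2] := Num.Theory.truncn_itv y0.
have tN : (Num.truncn (N%:R * x)%R < N)%N.
  by rewrite -(ltr_nat R); apply: le_lt_trans t1 _; rewrite -[ltRHS]mulr1 ltr_pM2l.
exists (Ordinal tN); rewrite /cell /= in_itv /=.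
by rewrite ler_pdivrMr // ltr_pdivlMr // ![x * _]mulrC t1 t2.
Qed.

Lemma measure_cell N i : (0 < N)%N -> @lebesgue_measure R (cell N i) = (N%:R^-1)%:E.
Proof.
move=> N0; have Np : 0 < N%:R :> R by rewrite ltr0n.
rewrite lebesgue_measure_itv /= lte_fin ltr_pM2r ?invr_gt0 // ltr_nat ltnSn.
by rewrite -EFinB -mulrBl -natr1 addrAC subrr add0r mul1r.
Qed.

Definition cube N (i : 'I_N * 'I_N * 'I_N) : set (R * R * R) :=
  cell N i.1.1 `*` cell N i.1.2 `*` cell N i.2.

Lemma measurable_cube N i : measurable (@cube N i).
Proof. by apply: measurableX; [apply: measurableX|]; exact: measurable_cell. Qed.

Lemma measure_cube N i : (0 < N)%N -> lebesgue3 R (@cube N i) = (N%:R^-1 ^+ 3)%:E.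
Proof.
move=> N0; rewrite /lebesgue3 /cube.
rewrite product_measure1E; [|by apply: measurableX; exact: measurable_cell|exact: measurable_cell].
rewrite [X in (X * _)%E](_ : _ = (N%:R^-1 * N%:R^-1)%:E); last first.
  have E2 := @product_measure1E _ _ _ _ R (@lebesgue_measure R) (@lebesgue_measure R) _ _
    (measurable_cell N i.1.1) (measurable_cell N i.1.2).
  exact: (etrans E2 (f_equal2 mule (measure_cell _ N0) (measure_cell _ N0))).
rewrite [X in (_ * X)%E](_ : _ = (N%:R^-1)%:E); last exact: measure_cell.
by rewrite -EFinM !exprS expr0 mulr1 mulrA.
Qed.

Lemma cube_disjoint N (i j : 'I_N * 'I_N * 'I_N) : (0 < N)%N -> i != j ->
  cube i `&` cube j = set0.
Proof.
move=> N0 ij; apply/seteqP; split => // -[[x y] z] [] [[/= a1 a2] a3] [[/= b1 b2] b3].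
have dj (k l : 'I_N) (w : R) : cell N k w -> cell N l w -> k = l.
  move=> kw lw; apply/val_inj/eqP; apply/negPn/negP => kl.
  have := cell_disjoint N0 kl; move/seteqP => [/(_ w) + _]; exact.
move/eqP: ij; apply; case: i j a1 a2 a3 b1 b2 b3 => [[i1 i2] i3] [[j1 j2] j3] /=.
by move=> a1 a2 a3 b1 b2 b3; rewrite (dj _ _ _ a1 b1) (dj _ _ _ a2 b2) (dj _ _ _ a3 b3).
Qed.

Lemma cube_cover N : (0 < N)%N -> unit_cube R = [set x | exists i, @cube N i x].
Proof.
move=> N0; apply/seteqP; split => [[[x y] z] [[/= hx hy] hz]|[[x y] z] [i [[/= hx hy] hz]]].
  have [i hi] := (cell_cover x N0).1 hx; have [j hj] := (cell_cover y N0).1 hy.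
  have [k hk] := (cell_cover z N0).1 hz.
  by exists (i, j, k).
by split; [split|] => /=; apply/(cell_cover _ N0); [exists i.1.1|exists i.1.2|exists i.2].
Qed.

Lemma exp_sum_factor (X a1 a2 a3 : R) :
  exp_sum X a1 a2 a3 = cubic_sum (Num.truncn X) a1 a3 * cubic_sum (Num.truncn X) a2 a3.
Proof.
rewrite /exp_sum /cubic_sum mulr_suml; apply: eq_bigr => x _; rewrite mulr_sumr; apply: eq_bigr => y _.
by rewrite -e_add; congr (e2pi _); ring.
Qed.

Definition integrand (P : nat) (a : R * R * R) : R :=
  (Normc.normc (cubic_sum P a.1.1 a.2) * Normc.normc (cubic_sum P a.1.2 a.2)) ^+ 5.

Lemma measurable_nc_cubic_sum P (f g : R * R * R -> R) :
  measurable_fun setT f -> measurable_fun setT g ->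
  measurable_fun setT (fun a => Normc.normc (cubic_sum P (f a) (g a))).
Proof.
move=> mf mg.
have -> : (fun a => Normc.normc (cubic_sum P (f a) (g a))) = (fun a => Num.sqrt (
    (\sum_(x <- rng P) cos (2 * pi * (f a * x%:R + g a * x%:R ^+ 3))) ^+ 2 +
    (\sum_(x <- rng P) sin (2 * pi * (f a * x%:R + g a * x%:R ^+ 3))) ^+ 2)).
  apply/funext => a.
  have E : cubic_sum P (f a) (g a) = Complex
      (\sum_(x <- rng P) cos (2 * pi * (f a * x%:R + g a * x%:R ^+ 3)))
      (\sum_(x <- rng P) sin (2 * pi * (f a * x%:R + g a * x%:R ^+ 3))).
    rewrite /cubic_sum; elim/big_rec3: _ => [|x u v w _ ->]; first by [].
    by [].
  by rewrite E.
have mlin x : measurable_fun setT (fun a => 2 * pi * (f a * x%:R + g a * x%:R ^+ 3)).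
  apply: measurable_funM => //; apply: measurable_funD; exact: measurable_funM.
apply: (measurableT_comp (continuous_measurable_fun (@sqrt_continuous R))).
apply: measurable_funD; apply: measurable_funX; apply: measurable_sum => x.
  exact: (measurableT_comp (continuous_measurable_fun (@continuous_cos R))).
exact: (measurableT_comp (continuous_measurable_fun (@continuous_sin R))).
Qed.

Lemma measurable_integrand P : measurable_fun setT (integrand P).
Proof.
have m1 : measurable_fun setT (fun a : R * R * R => a.1.1).
  exact: (measurableT_comp measurable_fst measurable_fst).
have m2 : measurable_fun setT (fun a : R * R * R => a.1.2).
  exact: (measurableT_comp measurable_snd measurable_fst).
by apply: measurable_funX; apply: measurable_funM; apply: measurable_nc_cubic_sum.
Qed.

Lemma expr5_lipschitz (u w M : R) : 0 <= u <= M -> 0 <= w <= M ->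
  `|u ^+ 5 - w ^+ 5| <= 5 * M ^+ 4 * `|u - w|.
Proof.
move=> /andP [u0 uM] /andP [w0 wM].
have M0 : 0 <= M by lra.
rewrite subrXX normrM mulrC ler_wpM2r //.
apply: le_trans (ler_norm_sum _ _ _) _.
apply: (@le_trans _ _ (\sum_(i < 5) M ^+ 4)); last by rewrite sumr_const card_ord mulr_natl.
apply: ler_sum => i _; rewrite normrM !normrX !ger0_norm //.
have -> : M ^+ 4 = M ^+ (5 - i.+1) * M ^+ i by rewrite -exprD; congr (_ ^+ _); have := ltn_ord i; lia.
by rewrite ler_pM ?exprn_ge0 // lerXn2r ?nnegrE.
Qed.

Lemma integrand_lipschitz P (a b : R * R * R) (eps : R) : (0 < P)%N -> 0 <= eps ->
  `|b.1.1 - a.1.1| <= eps -> `|b.1.2 - a.1.2| <= eps -> `|b.2 - a.2| <= eps ->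
  `|integrand P b - integrand P a| <= 160 * P%:R ^+ 13 * eps.
Proof.
move=> P0 e0 h1 h2 h3.
have P1 : 1 <= P%:R :> R by rewrite ler1n.
pose D : R := 16 * P%:R ^+ 4 * eps.
have step (a1 b1 a3 b3 : R) : `|b1 - a1| <= eps -> `|b3 - a3| <= eps ->
    `|Normc.normc (cubic_sum P b1 b3) - Normc.normc (cubic_sum P a1 a3)| <= D.
  move=> e1 e3.
  have P24 : P%:R ^+ 2 <= P%:R ^+ 4 :> R by rewrite -[4%N]/(2 + 2)%N exprD ler_peMr ?exprn_ge0 ?exprn_ege1.
  have E : 8 * (P%:R ^+ 2 * `|b1 - a1| + P%:R ^+ 4 * `|b3 - a3|) <= D.
    have : P%:R ^+ 2 * `|b1 - a1| <= P%:R ^+ 4 * eps by rewrite ler_pM ?exprn_ge0.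
    have : P%:R ^+ 4 * `|b3 - a3| <= P%:R ^+ 4 * eps by rewrite ler_wpM2l ?exprn_ge0.
    by rewrite /D; lra.
  rewrite ler_norml; have := cubic_sum_lipschitz P a1 b1 a3 b3; have := cubic_sum_lipschitz P b1 a1 b3 a3.
  by rewrite ![`|a1 - _|]distrC ![`|a3 - _|]distrC => l1 l2; apply/andP; split; lra.
have D0 : 0 <= D by rewrite !mulr_ge0 ?exprn_ge0.
have := step _ _ _ _ h1 h3; have := step _ _ _ _ h2 h3.
rewrite /integrand.
have := nc_cubic_sum_le P a.1.1 a.2; have := nc_cubic_sum_le P a.1.2 a.2.
have := nc_cubic_sum_le P b.1.1 b.2; have := nc_cubic_sum_le P b.1.2 b.2.
have := nc_ge0 (cubic_sum P a.1.1 a.2); have := nc_ge0 (cubic_sum P a.1.2 a.2).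
have := nc_ge0 (cubic_sum P b.1.1 b.2); have := nc_ge0 (cubic_sum P b.1.2 b.2).
move: (Normc.normc (cubic_sum P a.1.1 a.2)) (Normc.normc (cubic_sum P a.1.2 a.2))
  (Normc.normc (cubic_sum P b.1.1 b.2)) (Normc.normc (cubic_sum P b.1.2 b.2)) => u w u' w'.
move=> w'0 u'0 w0 u0 w'P u'P wP uP hw hu.
apply: (@le_trans _ _ (5 * (P%:R * P%:R) ^+ 4 * `|u' * w' - u * w|)).
  by apply: expr5_lipschitz; rewrite mulr_ge0 //= ler_pM.
have : `|u' * w' - u * w| <= P%:R * D + P%:R * D.
  have -> : u' * w' - u * w = u' * (w' - w) + (u' - u) * w by ring.
  apply: le_trans (ler_normD _ _) _; rewrite !normrM (ger0_norm u'0) (ger0_norm w0).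
  by apply: lerD; [|rewrite mulrC]; apply: ler_pM.
have c0 : 0 <= 5 * (P%:R * P%:R) ^+ 4 :> R by rewrite mulr_ge0 ?exprn_ge0 // mulr_ge0.
move/(ler_wpM2l c0)/le_trans; apply.
by rewrite /D le_eqVlt; apply/orP; left; apply/eqP; ring.
Qed.

Lemma riemann_sum_integrand N P :
  \sum_(i : 'I_N * 'I_N * 'I_N) integrand P (i.1.1%:R / N%:R, i.1.2%:R / N%:R, i.2%:R / N%:R) *
    N%:R^-1 ^+ 3 = N%:R^-1 * \sum_(j < N) moment N 5 P (j%:R / N%:R : R) ^+ 2.
Proof.
rewrite -mulr_suml mulrC exprS -mulrA; congr (_ * _).
rewrite -(pair_bigA _ (fun (i : 'I_N * 'I_N) (j : 'I_N) => integrand P (i.1%:R / N%:R, i.2%:R / N%:R, j%:R / N%:R))) /=.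
rewrite exchange_big /= mulr_sumr; apply: eq_bigr => j _.
rewrite /moment exprMn; congr (_ * _).
rewrite -(pair_bigA _ (fun (i i' : 'I_N) => integrand P (i%:R / N%:R, i'%:R / N%:R, j%:R / N%:R))) /=.
rewrite expr2 mulr_suml; apply: eq_bigr => i _; rewrite mulr_sumr; apply: eq_bigr => i' _.
by rewrite /integrand exprMn.
Qed.

(** A mesh finer than the reciprocal of the Lipschitz constant of the
    integrand suffices. *)
Lemma fifth_moment_riemann (X : R) (N : nat) :
  let P := Num.truncn X in (0 < P)%N -> (160 * P ^ 13 <= N)%N ->
  let S := N%:R^-1 * \sum_(j < N) moment N 5 P (j%:R / N%:R : R) ^+ 2 in
  ((S - 1)%:E <= fifth_moment X)%E /\ (fifth_moment X <= (S + 1)%:E)%E.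
Proof.
move=> P P0 PN S.
have N0 : (0 < N)%N by apply: leq_trans PN; rewrite muln_gt0 expn_gt0 P0.
have Np : 0 < N%:R :> R by rewrite ltr0n.
have -> : fifth_moment X = (\int[lebesgue3 R]_(a in unit_cube R) (integrand P a)%:E)%E.
  by apply: eq_integral => a _; rewrite exp_sum_factor ncM.
have [|||||||i x xi|lo hi] := @integral_cells _ _ (lebesgue3 R) _ (@cube N) (unit_cube R) (integrand P)
  (fun i => integrand P (i.1.1%:R / N%:R, i.1.2%:R / N%:R, i.2%:R / N%:R)) (N%:R^-1 ^+ 3) 1.
- exact: measurable_cube.
- by move=> i j; exact: cube_disjoint.
- exact: cube_cover.
- by move=> i; exact: measure_cube.
- by rewrite exprn_ge0 ?invr_ge0.
- exact: measurable_integrand.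
- by move=> x; rewrite exprn_ge0 // mulr_ge0 ?nc_ge0.
- case: xi => -[/= x1 x2] x3.
  apply: (le_trans (@integrand_lipschitz P (i.1.1%:R / N%:R, i.1.2%:R / N%:R, i.2%:R / N%:R) x N%:R^-1 P0 _ _ _ _)).
  + by rewrite invr_ge0.
  + exact: cell_dist.
  + exact: cell_dist.
  + exact: cell_dist.
  + by rewrite ler_pdivrMr // mul1r -natrX -natrM ler_nat.
have one : \sum_(i : 'I_N * 'I_N * 'I_N) N%:R^-1 ^+ 3 = 1 :> R.
  rewrite sumr_const !card_prod card_ord -[LHS]mulr_natl !natrM.
  by field; rewrite gt_eqF.
move: lo hi; under eq_bigr do rewrite mulrBl mul1r.
rewrite sumrB one riemann_sum_integrand => lo.
under eq_bigr do rewrite mulrDl mul1r.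
by rewrite big_split /= one riemann_sum_integrand.
Qed.

End Riemann.

(** * Order of magnitude of the fifth moment *)

Local Open Scope classical_set_scope.
Local Open Scope ring_scope.

Theorem corollary1p2 (R : realType) :
  asymp_large (@fifth_moment R) (fun X : R => (X ^+ 5)%:E).
Proof.
have [P0 upper] := discrete_upper R.
have C0 : 0 < upper_const R.
  by rewrite /upper_const !addr_gt0 // !mulr_gt0 // ?exprn_gt0.
exists (2 ^+ 6)^-1, (upper_const R + 1); split; [by rewrite invr_gt0 exprn_gt0 | lra |].
exists (P0 + 2)%:R; split; first exact: realn.
move=> X hX.
have X0 : 0 <= X by apply: le_trans (ltW hX).
have := Num.Theory.truncn_itv X0; set P := Num.truncn X => /andP [PX XP].
have PP0 : (P0 + 2 <= P)%N.
  by rewrite -ltnS -(ltr_nat R); exact: lt_trans hX XP.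
have P2 : 2 <= P%:R :> R by rewrite ler_nat; lia.
have Pg : (0 < P)%N by lia.
pose N := (6 * P ^ 3 + 160 * P ^ 13).+1.
have PN : (P < N)%N.
  rewrite ltnS; apply: leq_trans (leq_addr _ _); apply: (@leq_trans (P ^ 3)); last by rewrite leq_pmull.
  by rewrite -{1}[P]expn1 leq_pexp2l.
have [lo hi] := @fifth_moment_riemann R X N Pg (leqW (leq_addl _ _)).
have lower := discrete_lower R PN.
have {}upper := upper P N (leq_trans (leq_addr _ _) PP0) (leq_addr _ _ : (6 * P ^ 3 < N)%N).
set S := N%:R^-1 * _ in lo hi lower upper.
have p5 : 2 <= P%:R ^+ 5 :> R.
  by rewrite -[leLHS]mulr1 exprS ler_pM // exprn_ege1 //; lra.
split.
  apply: le_trans lo; rewrite -EFinM lee_fin.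
  have : X ^+ 5 <= (2 * P%:R) ^+ 5.
    by rewrite lerXn2r ?nnegrE ?mulr_ge0 //; rewrite -natr1 in XP; lra.
  rewrite exprMn => X5; rewrite ler_pdivrMl ?exprn_gt0 // (exprSr 2 5) -mulrA.
  apply: le_trans X5 _; rewrite ler_wpM2l ?exprn_ge0 //; lra.
apply: le_trans hi _; rewrite -EFinM lee_fin.
have PX5 : P%:R ^+ 5 <= X ^+ 5 by rewrite lerXn2r ?nnegrE.
have := ler_wpM2l (ltW C0) PX5; lra.
Qed.
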